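(* Let $n=4k+3$ with $k\ge1$ an integer, let $\sigma\in(0,1)$, $\tau>0$, $\delta_0\in(0,1)$ be constants. There is a constant $C=C(\sigma,\tau,\delta_0)>0$ such that the following holds. Let $(M^{n+1},g)$ be a simply connected non-positively curved conformally compact Einstein manifold with conformal infinity $(\mathbb{S}^n,[\hat g])$, where $\hat g$ is an $\mathrm{Sp}(k+1)$-invariant metric, and let $y_1,\dots,y_4$, $K=e^{y_1}$, $t_i=e^{y_{i+1}}$ be the associated functions on $[0,1]$ (see context). Assume that $\sigma<t_1(0),t_2(0),t_3(0)<\frac{n+5}{3}$, labelled so that $t_1(0)\ge t_2(0)\ge t_3(0)$, that $$t_i(0)^{-1}(t_j(0)+t_k(0))>1\quad\text{for any }\{i,j,k\}=\{1,2,3\},$$ and that $$2C_{13}C_{23}+2C_{13}+2C_{23}-C_{13}^2-C_{23}^2-1>\tau$$ for all constants $C_{13},C_{23}$ with $1\le C_{13}\le\frac{t_1(0)}{t_3(0)}$ and $1\le C_{23}\le\frac{t_2(0)}{t_3(0)}$. Assume that the Weyl tensor $W$ of $g$ satisfies $|W|_g\le\varepsilon$ on $M$ for some constant $0<\varepsilon\le T:=\sqrt{n(n^2-1)}$. Then $$|y_1^{(k)}(x)|\le C\,\varepsilon^2(1-x^2)^{4-k},\qquad |y_i^{(k)}(x)|\le C\,\varepsilon\,(1-x^2)^{2-k}$$ for $2\le i\le4$, $k=1,2$ and $x\in[\delta_0,1]$.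
   Context: Conformally compact Einstein (CCE): $\overline M$ is a smooth compact connected manifold of dimension $n+1$ with boundary $\partial M$ and interior $M$; a complete metric $g$ on $M$ is CCE if $\mathrm{Ric}_g=-ng$ and $\rho^2g$ extends continuously to a Riemannian metric $\bar g$ on $\overline M$ for some smooth $\rho$ on $\overline M$ with $\rho>0$ in $M$, $\rho=0$ and $d\rho\neq0$ on $\partial M$; its conformal infinity is $(\partial M,[\bar g|_{\partial M}])$. Homogeneous metrics: $\hat g$ is $\mathrm{Sp}(k+1)$-invariant on $\mathbb{S}^n=\mathrm{Sp}(k+1)/\mathrm{Sp}(k)$, written at a point $q$ as $\hat g=\lambda_1\sigma_1^2+\lambda_2\sigma_2^2+\lambda_3\sigma_3^2+\lambda_4(\sigma_4^2+\dots+\sigma_n^2)$, $\lambda_i>0$, where the $\sigma_i$ are dual to a basis of the $\mathrm{Ad}_{\mathrm{Sp}(k)}$-invariant complement $\mathfrak p\cong T_q\mathbb{S}^n$ of $\mathrm{sp}(k)$ in $\mathrm{sp}(k+1)$, $\sigma_1,\sigma_2,\sigma_3$ correspond to the 3-dimensional trivial summand of $\mathfrak p$ and $\sigma_4,\dots,\sigma_n$ to the $4k$-dimensional irreducible one, normalized so that $\sum\sigma_i^2$ is the unit round metric. Associated functions: for $(M,g)$ simply connected, non-positively curved, CCE, with conformal infinity $(\mathbb{S}^n,[\hat g])$, let $p_0\in M$ be the center of gravity, i.e. the center of the unique closed geodesic ball of smallest radius containing the set where $|W|_g$ attains $\sup_M|W|_g$ (if $g$ is hyperbolic, set all $y_i\equiv0$).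 The $\mathrm{Sp}(k+1)$-action extends to $(M,g)$ by isometries fixing $p_0$. With $r$ the distance to $p_0$ and $x=e^{-r}\in[0,1]$ one has $g=dr^2+\sinh^2(r)\bar h=x^{-2}\big(dx^2+\frac{(1-x^2)^2}{4}\bar h\big)$, and along the geodesic from $p_0$ to $q$, $\bar h=I_1(d\theta^1)^2+I_2(d\theta^2)^2+I_3(d\theta^3)^2+I_4\big((d\theta^4)^2+\dots+(d\theta^n)^2\big)$, where $\theta$ are coordinates on $\mathbb{S}^n$ near $q$ with $d\theta^i=\sigma_i$ at $q$ and $I_i\in C^\infty([0,1])$ are positive with $I_i(1)=1$. Put $K=I_1I_2I_3I_4^{n-3}$, $t_i=I_i/I_4$ ($1\le i\le3$), $y_1=\log K$, $y_{i+1}=\log t_i$. These functions satisfy the following boundary value problem. With $P=(K^{-1}t_1t_2t_3)^{1/n}$ and $$\Psi=((n-1)y_2'-y_3'-y_4')^2+(-y_2'+(n-1)y_3'-y_4')^2+(-y_2'-y_3'+(n-1)y_4')^2+(n-3)(y_2'+y_3'+y_4')^2,$$ $$y_1''-\tfrac{1+3x^2}{x(1-x^2)}y_1'+\tfrac{1}{2n^2}\big[n(y_1')^2+\Psi\big]=0,$$ $$y_1''-\tfrac{2n-1+(2n+1)x^2}{x(1-x^2)}y_1'+\tfrac12(y_1')^2+\tfrac{8}{(1-x^2)^2}\Big[n(n-1)-P\Big((n-3)(n+5)-(n-3)(t_1+t_2+t_3)+\tfrac{2(2t_1t_2+2t_1t_3+2t_2t_3-t_1^2-t_2^2-t_3^2)}{t_1t_2t_3}\Big)\Big]=0,$$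 and for each $\{a,b,c\}=\{1,2,3\}$ $$y_{a+1}''-\tfrac{n-1+(n+1)x^2}{x(1-x^2)}y_{a+1}'+\tfrac12y_1'y_{a+1}'-\tfrac{8P}{(1-x^2)^2}\Big[(n-1)t_a+2t_b+2t_c-n-5+\tfrac{2(t_a^2-(t_b-t_c)^2)}{t_1t_2t_3}\Big]=0,$$ with $t_i(0)=\lambda_i/\lambda_4$, $K(1)=t_i(1)=1$ ($1\le i\le3$), $y_j'(0)=y_j'(1)=0$ ($1\le j\le4$). $|W|_g$ is the full tensor norm of the Weyl tensor; non-positive curvature and the Einstein equation always give $|W|_g\le\sqrt{n(n^2-1)}$. $y^{(k)}$ denotes the $k$-th derivative in $x$. The dimension $n$ is fixed; constants may depend on it. *)

(* Defs.v *)
From HB Require Import structures.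
From mathcomp Require Import all_boot all_order all_algebra.
From mathcomp Require Import all_classical all_reals all_analysis.

Set Implicit Arguments.
Unset Strict Implicit.
Unset Printing Implicit Defensive.

Import Order.TTheory GRing.Theory Num.Theory.
Import numFieldNormedType.Exports.

Local Open Scope classical_set_scope.
Local Open Scope ring_scope.

Definition bil (R : realType) (m : nat) (B : 'M[R]_m) (v w : 'rV[R]_m) : R :=
  (v *m B *m w^T) 0 0.

Definition dot (R : realType) (m : nat) (v w : 'rV[R]_m) : R := (v *m w^T) 0 0.

Definition partial (R : realType) (m : nat) (i : 'I_m)
    (f : 'rV[R]_m -> R) (u : 'rV[R]_m) : R :=
  'D_(delta_mx 0 i : 'rV[R]_m) f u.

(* Vectors are rows, so the differential of F at u is v |-> v *m jac F u. *)
Definition jac (R : realType) (m p : nat) (F : 'rV[R]_m -> 'rV[R]_p)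
    (u : 'rV[R]_m) : 'M[R]_(m, p) :=
  \matrix_(i, j) partial i (fun w => F w 0 j) u.

(* Meaningful for open U only. *)
Fixpoint Ck (R : realType) (m k : nat) (U : set 'rV[R]_m)
    (f : 'rV[R]_m -> R) : Prop :=
  (forall u, U u -> {for u, continuous f}) /\
  match k with
  | 0%N => True
  | k'.+1 => forall i : 'I_m,
      (forall u, U u -> derivable f u (delta_mx 0 i : 'rV[R]_m)) /\
      Ck k' U (partial i f)
  end.

Definition smooth (R : realType) (m : nat) (U : set 'rV[R]_m)
    (f : 'rV[R]_m -> R) : Prop := forall k, Ck k U f.

(* F is a local smooth extension near u of the restriction of f to A. *)
Definition local_ext (R : realType) (m : nat) (A : set 'rV[R]_m)
    (f : 'rV[R]_m -> R) (u : 'rV[R]_m) (F : 'rV[R]_m -> R) : Prop :=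
  exists U : set 'rV[R]_m,
    [/\ open U, U u, smooth U F & forall w, A w -> U w -> f w = F w].

Definition smooth_on (R : realType) (m : nat) (A : set 'rV[R]_m)
    (f : 'rV[R]_m -> R) : Prop :=
  forall u, A u -> exists F, local_ext A f u F.

(* C^oo([0,1]) is represented by functions smooth on the whole line; only their
   values on [0,1] matter, and these determine the derivatives at 0 and 1. *)
Definition smooth1 (R : realType) (f : R -> R) : Prop :=
  forall (k : nat) (x : R), derivable (derive1n k f) x 1.

Definition sinh (R : realType) (r : R) : R := (expR r - expR (- r)) / 2.

(* Charts take values in the closed half space of R^(n+1); n.+1 is the dimension
   of the manifold. *)

Record chart (R : realType) (n : nat) (X : topologicalType) := Chart {
  dom : set X;
  coord : X -> 'rV[R]_n.+1;
  param : 'rV[R]_n.+1 -> X }.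

Definition half_space (R : realType) (n : nat) : set 'rV[R]_n.+1 :=
  [set u | 0 <= u 0 ord0].

Definition image (R : realType) (n : nat) (X : topologicalType)
    (c : chart R n X) : set 'rV[R]_n.+1 := coord c @` dom c.

(* Coordinates of the interior points; an open subset of R^(n+1). *)
Definition int_image (R : realType) (n : nat) (X : topologicalType)
    (c : chart R n X) : set 'rV[R]_n.+1 :=
  image c `&` [set u | 0 < u 0 ord0].

Record is_chart (R : realType) (n : nat) (X : topologicalType)
    (c : chart R n X) : Prop := IsChart {
  chart_dom_open : open (dom c);
  chart_image_open :
    exists O, open O /\ image c = O `&` @half_space R n;
  chart_paramK : forall p, dom c p -> param c (coord c p) = p;
  chart_coord_cont : forall p, dom c p -> {for p, continuous (coord c)};
  chart_param_cont : {within image c, continuous (param c)} }.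

Definition transition_smooth (R : realType) (n : nat) (X : topologicalType)
    (c1 c2 : chart R n X) : Prop :=
  forall j : 'I_n.+1, smooth_on (coord c1 @` (dom c1 `&` dom c2))
    (fun u => coord c2 (param c1 u) 0 j).

(* The atlas is the maximal one. *)
Record smooth_structure (R : realType) (n : nat) (X : topologicalType)
    (A : set (chart R n X)) : Prop := SmoothStructure {
  atlas_chart : forall c, A c -> is_chart c;
  atlas_cover : forall p, exists2 c, A c & dom c p;
  atlas_compat : forall c1 c2, A c1 -> A c2 -> transition_smooth c1 c2;
  atlas_max : forall c, is_chart c ->
    (forall c', A c' -> transition_smooth c c' /\ transition_smooth c' c) ->
    A c }.

Definition compact_connected_manifold (R : realType) (n : nat)
    (X : topologicalType) (A : set (chart R n X)) : Prop :=
  [/\ hausdorff_space X, compact [set: X], connected [set: X]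
    & smooth_structure A].

Definition mint (R : realType) (n : nat) (X : topologicalType)
    (A : set (chart R n X)) : set X :=
  [set p | exists c, [/\ A c, dom c p & 0 < coord c p 0 ord0]].

Definition mbd (R : realType) (n : nat) (X : topologicalType)
    (A : set (chart R n X)) : set X :=
  [set p | exists c, [/\ A c, dom c p & coord c p 0 ord0 = 0]].

Definition path_in (R : realType) (X : topologicalType) (M : set X)
    (a : R -> X) : Prop :=
  {within `[0, 1]%classic, continuous a} /\
  (forall t, 0 <= t <= 1 -> M (a t)).

Definition simply_connected (R : realType) (X : topologicalType)
    (M : set X) : Prop :=
  [/\ (exists p, M p),
      (forall p q, M p -> M q ->
         exists a : R -> X, [/\ path_in M a, a 0 = p & a 1 = q])
    & forall a : R -> X, path_in M a -> a 0 = a 1 ->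
      exists H : R * R -> X,
        [/\ {within `[0, 1]%classic `*` `[0, 1]%classic, continuous H},
            (forall s t, 0 <= s <= 1 -> 0 <= t <= 1 -> M (H (s, t))),
            (forall t, 0 <= t <= 1 -> H (0, t) = a t /\ H (1, t) = a 0)
          & (forall s, 0 <= s <= 1 -> H (s, 0) = a 0 /\ H (s, 1) = a 0)]].

(* G : 'rV_m -> 'M_m is the matrix of the metric as a function of the
    coordinates.  Conventions: R(d_i,d_j)d_k = riem_up i j k l . d_l,
    Riem(X,Y,Z,V) = <R(X,Y)Z,V>, sec(v,w) = Riem(v,w,w,v)/|v /\ w|^2. *)

Definition christoffel (R : realType) (m : nat) (G : 'rV[R]_m -> 'M[R]_m)
    (l i j : 'I_m) (u : 'rV[R]_m) : R :=
  2^-1 * \sum_s invmx (G u) l s *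
    (partial i (fun w => G w j s) u + partial j (fun w => G w i s) u
     - partial s (fun w => G w i j) u).

Definition riem_up (R : realType) (m : nat) (G : 'rV[R]_m -> 'M[R]_m)
    (i j k l : 'I_m) (u : 'rV[R]_m) : R :=
  partial i (christoffel G l j k) u - partial j (christoffel G l i k) u
  + \sum_s (christoffel G l i s u * christoffel G s j k u
            - christoffel G l j s u * christoffel G s i k u).

Definition riem (R : realType) (m : nat) (G : 'rV[R]_m -> 'M[R]_m)
    (i j k l : 'I_m) (u : 'rV[R]_m) : R :=
  \sum_s G u l s * riem_up G i j k s u.

Definition ric (R : realType) (m : nat) (G : 'rV[R]_m -> 'M[R]_m)
    (j k : 'I_m) (u : 'rV[R]_m) : R :=
  \sum_i riem_up G i j k i u.

Definition scal (R : realType) (m : nat) (G : 'rV[R]_m -> 'M[R]_m)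
    (u : 'rV[R]_m) : R :=
  \sum_i \sum_j invmx (G u) i j * ric G i j u.

Definition weyl (R : realType) (m : nat) (G : 'rV[R]_m -> 'M[R]_m)
    (i j k l : 'I_m) (u : 'rV[R]_m) : R :=
  riem G i j k l u
  - (G u i l * ric G j k u + G u j k * ric G i l u
     - G u i k * ric G j l u - G u j l * ric G i k u) / (m%:R - 2)
  + scal G u * (G u i l * G u j k - G u i k * G u j l)
      / ((m%:R - 1) * (m%:R - 2)).

Definition weyl_norm (R : realType) (m : nat) (G : 'rV[R]_m -> 'M[R]_m)
    (u : 'rV[R]_m) : R :=
  Num.sqrt (\sum_i \sum_j \sum_k \sum_l \sum_a \sum_b \sum_c \sum_d
    invmx (G u) i a * invmx (G u) j b * invmx (G u) k c * invmx (G u) l d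
    * weyl G i j k l u * weyl G a b c d u).

Definition area2 (R : realType) (m : nat) (B : 'M[R]_m) (v w : 'rV[R]_m) : R :=
  bil B v v * bil B w w - bil B v w ^+ 2.

Definition sec (R : realType) (m : nat) (G : 'rV[R]_m -> 'M[R]_m)
    (u v w : 'rV[R]_m) : R :=
  (\sum_i \sum_j \sum_k \sum_l
     v 0 i * w 0 j * w 0 k * v 0 l * riem G i j k l u) / area2 (G u) v w.

(* A metric is given by its matrices g c u, for charts c of the (maximal) atlas
    and u in the coordinate image of c. *)

Definition sym_posdef (R : realType) (m : nat) (B : 'M[R]_m) : Prop :=
  B^T = B /\ forall v : 'rV[R]_m, v != 0 -> 0 < bil B v v.

Definition riemannian_metric (R : realType) (n : nat) (X : topologicalType)
    (A : set (chart R n X)) (g : chart R n X -> 'rV[R]_n.+1 -> 'M[R]_n.+1) :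
    Prop :=
  [/\ (forall c u, A c -> int_image c u -> sym_posdef (g c u)),
      (forall c i j, A c -> smooth (int_image c) (fun u => g c u i j))
    & forall c1 c2 p, A c1 -> A c2 -> mint A p -> dom c1 p -> dom c2 p ->
      let J := jac (fun u => coord c2 (param c1 u)) (coord c1 p) in
      g c1 (coord c1 p) = J *m g c2 (coord c2 p) *m J^T].

Definition velocity (R : realType) (n : nat) (X : topologicalType)
    (c : chart R n X) (a : R -> X) (t : R) : 'rV[R]_n.+1 :=
  \row_i derive1 (fun s => coord c (a s) 0 i) t.

Definition C1_curve (R : realType) (n : nat) (X : topologicalType)
    (A : set (chart R n X)) (a : R -> X) : Prop :=
  [/\ continuous a, (forall t, mint A (a t))
    & forall c t i, A c -> dom c (a t) ->
      derivable (fun s => coord c (a s) 0 i) t 1 /\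
      {for t, continuous (derive1 (fun s => coord c (a s) 0 i))}].

Definition curve_length (R : realType) (n : nat) (X : topologicalType)
    (A : set (chart R n X)) (g : chart R n X -> 'rV[R]_n.+1 -> 'M[R]_n.+1)
    (a : R -> X) (L : R) : Prop :=
  exists speed : R -> R,
    (forall c t, A c -> 0 <= t <= 1 -> dom c (a t) ->
       speed t = Num.sqrt (bil (g c (coord c (a t)))
                             (velocity c a t) (velocity c a t))) /\
    L = Rintegral (@lebesgue_measure R) `[0, 1]%classic speed.

Definition dist (R : realType) (n : nat) (X : topologicalType)
    (A : set (chart R n X)) (g : chart R n X -> 'rV[R]_n.+1 -> 'M[R]_n.+1)
    (p q : X) : R :=
  inf [set L | exists a : R -> X,
    [/\ C1_curve A a, a 0 = p, a 1 = q & curve_length A g a L]].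

Definition complete_metric (R : realType) (n : nat) (X : topologicalType)
    (A : set (chart R n X)) (g : chart R n X -> 'rV[R]_n.+1 -> 'M[R]_n.+1) :
    Prop :=
  forall s : nat -> X, (forall i, mint A (s i)) ->
    (forall e : R, 0 < e -> exists N : nat, forall i j : nat,
       (N <= i)%N -> (N <= j)%N -> dist A g (s i) (s j) < e) ->
    exists2 p, mint A p & forall e : R, 0 < e -> exists N : nat, forall i : nat,
       (N <= i)%N -> dist A g (s i) p < e.

Definition nonpositively_curved (R : realType) (n : nat) (X : topologicalType)
    (A : set (chart R n X)) (g : chart R n X -> 'rV[R]_n.+1 -> 'M[R]_n.+1) :
    Prop :=
  forall c u v w, A c -> int_image c u -> area2 (g c u) v w != 0 ->
    sec (g c) u v w <= 0.

Definition hyperbolic (R : realType) (n : nat) (X : topologicalType)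
    (A : set (chart R n X)) (g : chart R n X -> 'rV[R]_n.+1 -> 'M[R]_n.+1) :
    Prop :=
  forall c u v w, A c -> int_image c u -> area2 (g c u) v w != 0 ->
    sec (g c) u v w = -1.

Definition einstein (R : realType) (n : nat) (X : topologicalType)
    (A : set (chart R n X)) (g : chart R n X -> 'rV[R]_n.+1 -> 'M[R]_n.+1) :
    Prop :=
  forall c u i j, A c -> int_image c u ->
    ric (g c) i j u = - n%:R * g c u i j.

Definition weyl_bound (R : realType) (n : nat) (X : topologicalType)
    (A : set (chart R n X)) (g : chart R n X -> 'rV[R]_n.+1 -> 'M[R]_n.+1)
    (eps : R) : Prop :=
  forall c u, A c -> int_image c u -> weyl_norm (g c) u <= eps.

Definition geodesic (R : realType) (n : nat) (X : topologicalType)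
    (A : set (chart R n X)) (g : chart R n X -> 'rV[R]_n.+1 -> 'M[R]_n.+1)
    (a : R -> X) : Prop :=
  C1_curve A a /\
  forall c t l, A c -> dom c (a t) ->
    let al' := derive1 (fun s => coord c (a s) 0 l) in
    derivable al' t 1 /\
    derive1 al' t + \sum_i \sum_j christoffel (g c) l i j (coord c (a t))
                  * velocity c a t 0 i * velocity c a t 0 j = 0.

Definition unit_speed (R : realType) (n : nat) (X : topologicalType)
    (A : set (chart R n X)) (g : chart R n X -> 'rV[R]_n.+1 -> 'M[R]_n.+1)
    (a : R -> X) : Prop :=
  forall c t, A c -> dom c (a t) ->
    bil (g c (coord c (a t))) (velocity c a t) (velocity c a t) = 1.

(* rho is a smooth defining function of the boundary, and gbar is the continuous
   extension of rho^2 g to a Riemannian metric up to the boundary. *)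
Definition compactification (R : realType) (n : nat) (X : topologicalType)
    (A : set (chart R n X)) (g : chart R n X -> 'rV[R]_n.+1 -> 'M[R]_n.+1)
    (rho : X -> R) (gbar : chart R n X -> 'rV[R]_n.+1 -> 'M[R]_n.+1) : Prop :=
  [/\ (forall c, A c -> smooth_on (image c) (fun u => rho (param c u))),
      (forall p, mint A p -> 0 < rho p),
      (forall p, mbd A p -> rho p = 0),
      (forall c p, A c -> mbd A p -> dom c p -> forall F,
         local_ext (image c) (fun u => rho (param c u)) (coord c p) F ->
         exists i, partial i F (coord c p) != 0)
    & forall c, A c ->
      [/\ (forall i j, {within image c, continuous (fun u => gbar c u i j)}),
          (forall u, image c u -> sym_posdef (gbar c u))
        & forall u, int_image c u ->
            gbar c u = rho (param c u) ^+ 2 *: g c u]].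

Record CCE (R : realType) (n : nat) (X : topologicalType)
    (A : set (chart R n X)) (g : chart R n X -> 'rV[R]_n.+1 -> 'M[R]_n.+1) :
    Prop := IsCCE {
  cce_manifold : compact_connected_manifold A;
  cce_metric : riemannian_metric A g;
  cce_complete : complete_metric A g;
  cce_einstein : einstein A g;
  cce_compact : exists rho gbar, compactification A g rho gbar }.

Definition sphere (R : realType) (m : nat) : set 'rV[R]_m :=
  [set v | dot v v = 1].

Definition tangent (R : realType) (m : nat) (v xi : 'rV[R]_m) : Prop :=
  dot v xi = 0.

Definition normalize (R : realType) (m : nat) (w : 'rV[R]_m) : 'rV[R]_m :=
  (Num.sqrt (dot w w))^-1 *: w.

(* (boundary, [gbar]) is identified with (S^n, [ghat]) by the diffeomorphism
   phi; ghat v is a bilinear form on R^(n+1), of which only the restriction to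
   the tangent space of S^n at v matters.  Maps on S^n are differentiated through
   their extension constant along rays.  A smooth bijection with
   nondegenerate pullback is a diffeomorphism. *)
Definition conformal_infinity (R : realType) (n : nat) (X : topologicalType)
    (A : set (chart R n X)) (g : chart R n X -> 'rV[R]_n.+1 -> 'M[R]_n.+1)
    (ghat : 'rV[R]_n.+1 -> 'M[R]_n.+1) (phi : 'rV[R]_n.+1 -> X) : Prop :=
  [/\ set_bij (@sphere R n.+1) (mbd A) phi,
      {within @sphere R n.+1, continuous phi},
      (forall c j, A c ->
         smooth [set w | w != 0 /\ dom c (phi (normalize w))]
           (fun w => coord c (phi (normalize w)) 0 j))
    & exists rho gbar, compactification A g rho gbar /\
      exists f : 'rV[R]_n.+1 -> R,
        forall v, sphere v -> 0 < f v /\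
        forall c xi eta, A c -> dom c (phi v) -> tangent v xi ->
          tangent v eta ->
          let J := jac (fun w => coord c (phi (normalize w))) v in
          bil (gbar c (coord c (phi v))) (xi *m J) (eta *m J)
          = f v * bil (ghat v) xi eta].

(* (1, i, j, k)-coordinates of q i and q j for q = x0 + x1 i + x2 j + x3 k:
   entry (a, b) is the e_b-coordinate of e_a i, resp. e_a j. *)
Definition quat_i (R : realType) : seq (seq R) :=
  [:: [:: 0; 1; 0; 0]; [:: -1; 0; 0; 0]; [:: 0; 0; 0; -1]; [:: 0; 0; 1; 0]].
Definition quat_j (R : realType) : seq (seq R) :=
  [:: [:: 0; 0; 1; 0]; [:: 0; 0; 0; 1]; [:: -1; 0; 0; 0]; [:: 0; -1; 0; 0]].

(* H^(m/4) = R^m by consecutive blocks of four coordinates; v *m quat_mx E is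
   right scalar multiplication of v by the unit quaternion with table E. *)
Definition quat_mx (R : realType) (m : nat) (E : seq (seq R)) : 'M[R]_m :=
  \matrix_(i, j) if (i %/ 4 == j %/ 4)%N
                 then nth 0 (nth [::] E (i %% 4)%N) (j %% 4)%N else 0.

Definition Sp (R : realType) (m : nat) : set 'M[R]_m :=
  [set S | [/\ S *m S^T = 1%:M,
               S *m quat_mx m (quat_i R) = quat_mx m (quat_i R) *m S
             & S *m quat_mx m (quat_j R) = quat_mx m (quat_j R) *m S]].

Definition Sp_invariant (R : realType) (m : nat)
    (ghat : 'rV[R]_m -> 'M[R]_m) : Prop :=
  forall S v xi eta, @Sp R m S -> sphere v -> tangent v xi -> tangent v eta ->
    bil (ghat (v *m S)) (xi *m S) (eta *m S) = bil (ghat v) xi eta.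

(* The weight index of the i-th direction: 0, 1, 2 on the trivial summand, and
   3 on the 4k-dimensional one. *)
Definition wt (n : nat) (i : 'I_n) : 'I_4 := inord (minn i 3).

(* The rows of e form the basis of T_q S^n dual to sigma_1, .., sigma_n; the
   isotropy group of q fixes exactly the first three of them. *)
Definition adapted_basis (R : realType) (n : nat) (q : 'rV[R]_n.+1)
    (e : 'M[R]_(n, n.+1)) : Prop :=
  [/\ sphere q,
      e *m e^T = 1%:M,
      (forall i, tangent q (row i e))
    & forall (i : 'I_n) S, (i < 3)%N -> @Sp R n.+1 S -> q *m S = q ->
        row i e *m S = row i e].

Definition homogeneous_metric (R : realType) (n : nat)
    (ghat : 'rV[R]_n.+1 -> 'M[R]_n.+1) (q : 'rV[R]_n.+1)
    (e : 'M[R]_(n, n.+1)) (lambda : 'I_4 -> R) : Prop :=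
  [/\ Sp_invariant ghat, adapted_basis q e, (forall a, 0 < lambda a)
    & forall xi eta, tangent q xi -> tangent q eta ->
        bil (ghat q) xi eta =
        \sum_(i < n) lambda (wt i) * dot xi (row i e) * dot eta (row i e)].

Definition weyl_argmax (R : realType) (n : nat) (X : topologicalType)
    (A : set (chart R n X)) (g : chart R n X -> 'rV[R]_n.+1 -> 'M[R]_n.+1) :
    set X :=
  [set p | mint A p /\ forall c, A c -> dom c p ->
     forall c' u, A c' -> int_image c' u ->
       weyl_norm (g c') u <= weyl_norm (g c) (coord c p)].

Definition closed_gball (R : realType) (n : nat) (X : topologicalType)
    (A : set (chart R n X)) (g : chart R n X -> 'rV[R]_n.+1 -> 'M[R]_n.+1)
    (p : X) (r : R) : set X :=
  [set p' | mint A p' /\ dist A g p p' <= r].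

Definition center_of_gravity (R : realType) (n : nat) (X : topologicalType)
    (A : set (chart R n X)) (g : chart R n X -> 'rV[R]_n.+1 -> 'M[R]_n.+1)
    (p0 : X) : Prop :=
  mint A p0 /\
  exists2 r0 : R, weyl_argmax A g `<=` closed_gball A g p0 r0 &
    forall p r, mint A p -> weyl_argmax A g `<=` closed_gball A g p r ->
      r0 <= r /\ (r = r0 -> p = p0).

(* ray v is the unit speed geodesic from p0 to the boundary point phi v.  The
   chart c has coordinates (r, theta), where theta are local coordinates on S^n
   near q, with inverse Theta, d/dtheta^i = e_i at q, and theta is constant
   along the rays.  The metric is dr^2 + sinh(r)^2 hbar, with hbar diagonal on
   the ray to q; Ifun is a function of x = exp(-r). *)
Definition polar_form (R : realType) (n : nat) (X : topologicalType)
    (A : set (chart R n X)) (g : chart R n X -> 'rV[R]_n.+1 -> 'M[R]_n.+1)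
    (phi : 'rV[R]_n.+1 -> X) (q : 'rV[R]_n.+1) (e : 'M[R]_(n, n.+1))
    (p0 : X) (Ifun : 'I_4 -> R -> R) : Prop :=
  exists (ray : 'rV[R]_n.+1 -> R -> X) (c : chart R n X)
         (V : set 'rV[R]_n) (Theta : 'rV[R]_n -> 'rV[R]_n.+1)
         (theta0 : 'rV[R]_n) (hbar : R -> 'rV[R]_n -> 'M[R]_n),
  [/\ (forall v, sphere v ->
         [/\ geodesic A g (ray v), unit_speed A g (ray v), ray v 0 = p0
           & ray v r @[r --> +oo] --> phi v]),
      [/\ open V, V theta0,
          (forall th, V th -> sphere (Theta th)),
          (forall j, smooth V (fun th => Theta th 0 j))
        & Theta theta0 = q /\ jac Theta theta0 = e],
      [/\ A c,
          image c =
            [set u : 'rV[R]_n.+1 | 0 < u 0 ord0 /\ V (@rsubmx R 1 1 n u)]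
        & forall p, dom c p ->
            let r := coord c p 0 ord0 in
            let th := @rsubmx R 1 1 n (coord c p) in
            r = dist A g p0 p /\ p = ray (Theta th) r],
      (forall u, image c u ->
         let r := u 0 ord0 in
         let th := @rsubmx R 1 1 n u in
         g c u = lift0_mx (sinh r ^+ 2 *: hbar (expR (- r)) th))
    & forall r, 0 < r ->
        hbar (expR (- r)) theta0 =
        diag_mx (\row_(i < n) Ifun (wt i) (expR (- r)))].

(* y 0, .., y 3 are the functions y_1, .., y_4; Ifun 0, .., Ifun 3 are
   I_1, .., I_4. *)
Definition associated_functions (R : realType) (n : nat) (X : topologicalType)
    (A : set (chart R n X)) (g : chart R n X -> 'rV[R]_n.+1 -> 'M[R]_n.+1)
    (phi : 'rV[R]_n.+1 -> X) (q : 'rV[R]_n.+1) (e : 'M[R]_(n, n.+1))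
    (y : 'I_4 -> R -> R) : Prop :=
  [/\ (forall j, smooth1 (y j)),
      (hyperbolic A g -> forall j x, 0 <= x <= 1 -> y j x = 0)
    & ~ hyperbolic A g ->
      exists (p0 : X) (Ifun : 'I_4 -> R -> R),
      [/\ center_of_gravity A g p0,
          (forall a, [/\ smooth1 (Ifun a), Ifun a 1 = 1
                       & forall x, 0 <= x <= 1 -> 0 < Ifun a x]),
          polar_form A g phi q e p0 Ifun
        & forall x, 0 <= x <= 1 ->
            y ord0 x = ln ((\prod_(i < 3) Ifun (widen_ord (leqnSn 3) i) x)
                           * Ifun ord_max x ^+ (n - 3)) /\
            forall i : 'I_3, y (lift ord0 i) x =
              ln (Ifun (widen_ord (leqnSn 3) i) x / Ifun ord_max x)]].

(* Main.v *)
Require Import Defs.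
From HB Require Import structures.
From mathcomp Require Import all_boot all_order all_algebra.
From mathcomp Require Import all_classical all_reals all_analysis.
From mathcomp Require Import ring lra.

Set Implicit Arguments.
Unset Strict Implicit.
Unset Printing Implicit Defensive.

Import Order.TTheory GRing.Theory Num.Theory.
Import numFieldNormedType.Exports.

Local Open Scope classical_set_scope.
Local Open Scope ring_scope.

(** On the region x >= delta0 the distance r = - ln x to the center of gravity is
    bounded, so the estimates are local consequences of the curvature bounds along
    the geodesic from the center to q.

    Along this ray the metric is diagonal, with angular entries
    a_i = sinh(r)^2 I_i(exp(-r)). For such a metric the radial sectional curvature
    in the i-th direction depends only on the restriction of a_i to the ray
    ([riem_radial]): with u_i half the derivative of ln I_i in r, it equals
    -(1 + w_i), where

       u_i' + u_i^2 + 2 coth(r) u_i = w_i.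

    Nonpositive curvature says w_i >= -1, the Weyl bound says |w_i| <= eps (for an
    Einstein metric of this normalization, w_i is up to sign a component of the
    Weyl tensor in an orthonormal frame), and the Ricci equation in the radial
    direction says that the w_i sum to zero ([frame_curvature],
    [polar_curvature]).

    A Wronskian comparison with the hyperbolic Jacobi field sinh then gives
    |u_i| <= eps r ([riccati_bound]). The sum U of all u_i satisfies the summed
    equation, whose forcing is only minus the sum of the u_i^2, of order
    eps^2 r^2; hence |U| <= n eps^2 r^3 ([riccati_trace_bound]). The equations
    themselves bound u_i' by a multiple of eps and U' by a multiple of eps^2 r^2.
    As ln K has radial derivative 2 U, and ln t_i has radial derivative
    2 (u_i - u_4), the change of variable x = exp(-r), under which r is at most
    (1 - x^2) / delta0, turns these into the claimed powers of 1 - x^2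
    ([radial_decay_bound]). *)

(** * Calculus on the real line *)

Section Calculus.
Context {R : realType}.
Implicit Types (f g : R -> R) (x r a b : R).

(** Pointwise forms of the differentiation rules, so that the derivative of an
    expression can be built as a term from the derivatives of its parts. *)
Lemma der_cst a x : is_derive x 1 (fun _ : R => a) 0.
Proof. exact: is_derive_cst. Qed.

Lemma der_id x : is_derive x 1 (fun y : R => y) 1.
Proof. exact: is_derive_id. Qed.

Lemma derD f g x a b : is_derive x 1 f a -> is_derive x 1 g b ->
  is_derive x 1 (fun y => f y + g y) (a + b).
Proof. by move=> fa gb; exact: is_deriveD. Qed.

Lemma derN f x a : is_derive x 1 f a -> is_derive x 1 (fun y => - f y) (- a).
Proof. by move=> fa; exact: is_deriveN. Qed.

Lemma derM f g x a b : is_derive x 1 f a -> is_derive x 1 g b ->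
  is_derive x 1 (fun y => f y * g y) (a * g x + f x * b).
Proof.
move=> fa gb; have := is_deriveM fa gb.
by congr is_derive; rewrite /GRing.scale /=; ring.
Qed.

Lemma derV f x a : f x != 0 -> is_derive x 1 f a ->
  is_derive x 1 (fun y => (f y)^-1) (- a / f x ^+ 2).
Proof.
move=> fx fa; have := is_deriveV fx fa.
by congr is_derive; rewrite /GRing.scale /=; field.
Qed.

Lemma der_comp f g x a b : is_derive (g x) 1 f a -> is_derive x 1 g b ->
  is_derive x 1 (fun y => f (g y)) (a * b).
Proof. by move=> fa gb; exact: is_derive1_comp. Qed.

Lemma der_sum n (F : 'I_n -> R -> R) (a : 'I_n -> R) x :
  (forall i, is_derive x 1 (F i) (a i)) ->
  is_derive x 1 (fun y => \sum_i F i y) (\sum_i a i).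
Proof.
move=> Fa; have := is_derive_sum Fa.
by congr is_derive; apply/funext => y; rewrite fct_sumE.
Qed.

Lemma der_cont f x a : is_derive x 1 f a -> {for x, continuous f}.
Proof.
by move=> fa; apply/differentiable_continuous/derivable1_diffP/ex_derive.
Qed.

Lemma der_eq f x a b : is_derive x 1 f a -> a = b -> is_derive x 1 f b.
Proof. by move=> fa <-. Qed.

Lemma der_unique f x a b : is_derive x 1 f a -> is_derive x 1 f b -> a = b.
Proof. by move=> [_ <-] [_ <-]. Qed.

Lemma der_ge0_le f (df : R -> R) r :
  (forall x, 0 <= x -> is_derive x 1 f (df x)) ->
  (forall x, 0 < x -> 0 <= df x) -> 0 <= r -> f 0 <= f r.
Proof.
move=> fdf df0; rewrite le_eqVlt => /predU1P[<- //|r0].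
have [||c + fE] := @MVT R f df 0 r r0.
- by move=> x; rewrite in_itv /= => /andP[/ltW x0 _]; exact: fdf.
- apply: derivable_within_continuous => x; rewrite in_itv /= => /andP[x0 _].
  by apply: ex_derive; exact: fdf.
rewrite in_itv /= => /andP[c0 _].
by rewrite -subr_ge0 fE mulr_ge0 ?df0// subr0 ltW.
Qed.

End Calculus.

(** * Hyperbolic functions *)

Section Hyperbolic.
Context {R : realType}.
Implicit Types r : R.

Definition cosh (r : R) : R := (expR r + expR (- r)) / 2.

Lemma der_expN r : is_derive r 1 (fun s : R => expR (- s)) (- expR (- r)).
Proof.
have := der_comp (is_derive_expR (- r)) (derN (der_id r)).
by rewrite mulrN1.
Qed.

Lemma der_sinh r : is_derive r 1 (@sinh R) (cosh r).
Proof.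
rewrite /sinh; apply: (der_eq (derM (derD (is_derive_expR r) (derN (der_expN r)))
  (der_cst 2^-1 r))).
by rewrite /cosh; ring.
Qed.

Lemma der_cosh r : is_derive r 1 cosh (sinh r).
Proof.
rewrite /cosh; apply: (der_eq (derM (derD (is_derive_expR r) (der_expN r))
  (der_cst 2^-1 r))).
by rewrite /sinh; ring.
Qed.

Lemma sinh0 : sinh 0 = 0 :> R.
Proof. by rewrite /sinh oppr0 subrr mul0r. Qed.

Lemma cosh_gt0 r : 0 < cosh r.
Proof. by rewrite /cosh divr_gt0// addr_gt0// expR_gt0. Qed.

Lemma cosh2 r : cosh r ^+ 2 = 1 + sinh r ^+ 2.
Proof.
have e1 : expR r * expR (- r) = 1 by rewrite expRN divff// gt_eqF// expR_gt0.
suff -> : cosh r ^+ 2 = expR r * expR (- r) + sinh r ^+ 2 by rewrite e1.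
by rewrite /cosh /sinh; field.
Qed.

Lemma cosh_ge1 r : 1 <= cosh r.
Proof.
have := cosh2 r; have := cosh_gt0 r; have := sqr_ge0 (sinh r); nra.
Qed.

Lemma le_sinh r : 0 <= r -> r <= sinh r.
Proof.
move=> r0.
have := der_ge0_le (fun x _ => derD (der_sinh x) (derN (der_id x))) _ r0.
rewrite sinh0 subrr subr_ge0; apply => x _.
by rewrite subr_ge0 cosh_ge1.
Qed.

Lemma sinh_gt0 r : 0 < r -> 0 < sinh r.
Proof. by move=> r0; apply: lt_le_trans (le_sinh (ltW r0)). Qed.

(** Tames the singular coefficient coth r of the Riccati equation near r = 0. *)
Lemma coth_le r : 0 < r -> r * (cosh r / sinh r) <= expR r.
Proof.
move=> r0; have s0 := sinh_gt0 r0.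
rewrite mulrA ler_pdivrMr//.
have c0 := cosh_gt0 r.
have ce : cosh r <= expR r.
  have : expR (- r) <= expR r by rewrite ler_expR; lra.
  by rewrite /cosh; lra.
have := le_sinh (ltW r0); have := expR_gt0 r; nra.
Qed.

End Hyperbolic.

(** * Comparison for the Riccati equation *)

Section Riccati.
Context {R : realType}.
Implicit Types r : R.

(** The heart of the estimate. With f = sinh * E one has f'' = (1 + w) f, the
    Jacobi equation of a curvature -(1 + w), and sinh * f * u is the Wronskian
    f' sinh - f cosh of f with the hyperbolic solution, whose derivative is
    w * f * sinh. Since w >= -1, f is convex, so sinh * f increases and
    eps * r * sinh * f grows at least as fast as the Wronskian in absolute
    value; both vanish at 0. *)
Lemma riccati_bound (E u du : R -> R) (eps : R) :
  (forall r, 0 <= r -> 0 < E r) ->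
  (forall r, 0 <= r -> is_derive r 1 E (u r * E r)) ->
  (forall r, 0 <= r -> is_derive r 1 u (du r)) ->
  (forall r, 0 < r ->
     let w := du r + u r ^+ 2 + 2 * (cosh r / sinh r) * u r in
     -1 <= w /\ `|w| <= eps) ->
  forall r, 0 < r -> `|u r| <= eps * r.
Proof.
move=> E0 dE du_ wP r r0.
pose w s := du s + u s ^+ 2 + 2 * (cosh s / sinh s) * u s.
have eps0 : 0 <= eps by have [_] := wP 1 ltr01; apply: le_trans.
have wE (s : R) : 0 < s -> sinh s * (du s + u s ^+ 2)
    = sinh s * w s - 2 * cosh s * u s.
  by move=> s0; rewrite /w; field; rewrite gt_eqF// sinh_gt0.
(* f1 is the derivative of sinh * E, and f1' = sinh * E * (1 + w). *)
pose f1 s := (cosh s + sinh s * u s) * E s.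
have df1 (s : R) : 0 <= s -> is_derive s 1 f1
    ((sinh s + 2 * cosh s * u s + sinh s * (du s + u s ^+ 2)) * E s).
  move=> s0; apply: (der_eq (derM (derD (der_cosh s)
    (derM (der_sinh s) (du_ s s0))) (dE s s0))).
  by ring.
have f1_ge0 (s : R) : 0 <= s -> 0 <= f1 s.
  move=> s0; apply: le_trans (der_ge0_le df1 _ s0); last first.
    move=> t t0; have [w1 _] := wP t t0.
    have := sinh_gt0 t0; have := E0 t (ltW t0); have := wE t t0.
    rewrite -/(w t) in w1 => -> Et st.
    rewrite mulr_ge0 ?(ltW Et)//.
    suff : 0 <= sinh t * (1 + w t) by lra.
    by rewrite mulr_ge0 ?(ltW st)//; lra.
  by rewrite /f1 sinh0 mul0r addr0 mulr_ge0 ?(ltW (cosh_gt0 _)) ?ltW ?E0.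
(* The signs c = 1 and c = -1 of this barrier give the two sides of the bound. *)
have dpsi c (s : R) : 0 <= s -> is_derive s 1
    (fun t => (eps * t + c * u t) * (sinh t * (sinh t * E t)))
    ((eps + c * du s) * (sinh s * (sinh s * E s))
     + (eps * s + c * u s) * (cosh s * (sinh s * E s) + sinh s * f1 s)).
  move=> s0; apply: (der_eq (derM (derD (derM (der_cst eps s) (der_id s))
                       (derM (der_cst c s) (du_ s s0)))
       (derM (der_sinh s) (derM (der_sinh s) (dE s s0))))).
  by rewrite /f1; ring.
have psi_ge0 c : c = 1 \/ c = -1 ->
    0 <= (eps * r + c * u r) * (sinh r * (sinh r * E r)).
  move=> cP; have := der_ge0_le (dpsi c) _ (ltW r0).
  rewrite sinh0 !mul0r !mulr0; apply => s s0.
  have [w1 weps] := wP s s0; rewrite -/(w s) in w1 weps.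
  have ss := sinh_gt0 s0; have Es := E0 s (ltW s0).
  have f1s := f1_ge0 s (ltW s0).
  have cs := cosh_gt0 s.
  have -> : (eps + c * du s) * (sinh s * (sinh s * E s))
     + (eps * s + c * u s) * (cosh s * (sinh s * E s) + sinh s * f1 s)
    = eps * s * (cosh s * (sinh s * E s) + sinh s * f1 s)
      + sinh s * E s * (eps * sinh s
          + c * (sinh s * (du s + u s ^+ 2) + 2 * cosh s * u s)).
    by rewrite /f1; ring.
  rewrite wE// subrK.
  apply: addr_ge0.
    have eps_s : 0 <= eps * s by rewrite mulr_ge0 ?(ltW s0).
    have ssE : 0 <= sinh s * E s by rewrite mulr_ge0 ?ltW.
    by rewrite mulr_ge0// addr_ge0// mulr_ge0 ?(ltW cs) ?(ltW ss).
  apply: mulr_ge0; first by apply: mulr_ge0; exact: ltW.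
  have -> : eps * sinh s + c * (sinh s * w s) = sinh s * (eps + c * w s) by ring.
  apply: mulr_ge0; first exact: ltW.
  by move: weps; rewrite ler_norml => /andP[? ?]; case: cP => ->; lra.
have sE : 0 < sinh r * (sinh r * E r).
  exact: (mulr_gt0 (sinh_gt0 r0) (mulr_gt0 (sinh_gt0 r0) (E0 r (ltW r0)))).
have p1 := psi_ge0 1 (or_introl erefl).
have p2 := psi_ge0 (-1) (or_intror erefl).
rewrite !pmulr_lge0// in p1 p2.
by rewrite ler_norml; apply/andP; split; lra.
Qed.

(** The trace of the Riccati equation of an Einstein metric has no linear
    forcing, only the quadratic S: (sinh^2 U)' = - sinh^2 S. This is where the
    gain of a second power of eps comes from. *)
Lemma riccati_trace_bound (U dU S : R -> R) (c : R) :
  (forall r : R, 0 <= r -> is_derive r 1 U (dU r)) ->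
  (forall r : R, 0 < r -> dU r + 2 * (cosh r / sinh r) * U r = - S r) ->
  (forall r : R, 0 < r -> 0 <= S r <= c * r ^+ 2) ->
  forall r : R, 0 < r -> `|U r| <= c * r ^+ 3.
Proof.
move=> dU_ UE Sc r r0.
have c0 : 0 <= c.
  by have /andP[S0 S1] := Sc 1 ltr01; move: (le_trans S0 S1); rewrite expr1n mulr1.
have dpsi e (s : R) : 0 <= s -> is_derive s 1
    (fun t => (c * (t * (t * t)) + e * U t) * (sinh t * sinh t))
    ((3 * c * s ^+ 2 + e * dU s) * (sinh s * sinh s)
     + (c * s ^+ 3 + e * U s) * (2 * (sinh s * cosh s))).
  move=> s0; apply: (der_eq (derM (derD
      (derM (der_cst c s) (derM (der_id s) (derM (der_id s) (der_id s))))
      (derM (der_cst e s) (dU_ s s0))) (derM (der_sinh s) (der_sinh s)))).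
  by ring.
have psi_ge0 e : e = 1 \/ e = -1 ->
    0 <= (c * (r * (r * r)) + e * U r) * (sinh r * sinh r).
  move=> eP; have := der_ge0_le (dpsi e) _ (ltW r0).
  rewrite sinh0 !mul0r !mulr0; apply => s s0.
  have ss := sinh_gt0 s0; have cs := cosh_gt0 s.
  have /andP[S0 S1] := Sc s s0.
  have -> : (3 * c * s ^+ 2 + e * dU s) * (sinh s * sinh s)
     + (c * s ^+ 3 + e * U s) * (2 * (sinh s * cosh s))
    = 3 * c * s ^+ 2 * (sinh s * sinh s) + c * s ^+ 3 * (2 * (sinh s * cosh s))
      + e * (sinh s * sinh s) * (dU s + 2 * (cosh s / sinh s) * U s).
    by field; rewrite gt_eqF.
  rewrite UE//.
  have cs3 : 0 <= c * s ^+ 3 by rewrite mulr_ge0// exprn_ge0// ltW.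
  have t2 : 0 <= c * s ^+ 3 * (2 * (sinh s * cosh s)).
    by rewrite mulr_ge0// mulr_ge0// (mulr_ge0 (ltW ss) (ltW cs)).
  suff : 0 <= (3 * c * s ^+ 2 - e * S s) * (sinh s * sinh s) by lra.
  apply: mulr_ge0; last by apply: mulr_ge0; exact: ltW.
  by case: eP => ->; lra.
have sE : 0 < sinh r * sinh r by apply: mulr_gt0; exact: sinh_gt0.
have p1 := psi_ge0 1 (or_introl erefl).
have p2 := psi_ge0 (-1) (or_intror erefl).
rewrite !pmulr_lge0// in p1 p2.
have -> : r ^+ 3 = r * (r * r) by ring.
by rewrite ler_norml; apply/andP; split; lra.
Qed.

End Riccati.

(** * Curvature along a ray with diagonal metric *)

Section Polar.
Context {R : realType} {n : nat}.
Implicit Types (r : R) (f : 'rV[R]_n.+1 -> R) (D : set 'rV[R]_n.+1).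

Lemma derive_line f (u v : 'rV[R]_n.+1) :
  'D_v f u = 'D_1 (fun h : R => f (h *: v + u)) 0.
Proof.
have E : (fun h : R => h^-1 *: ((f \o shift u) (h *: v) - f u)) =
    (fun h : R => h^-1 *: (((fun h : R => f (h *: v + u)) \o shift 0) (h *: (1 : R))
                           - f (0 *: v + u))).
  apply/funext => h /=; rewrite scale0r add0r addr0.
  by rewrite [h *: (1 : R)]mulr1.
by rewrite /derive E.
Qed.

(** All that directional derivatives see of openness. *)
Definition line_open D :=
  forall u v : 'rV[R]_n.+1, D u -> \forall h \near (0 : R), D (h *: v + u).

Lemma partial_cst D f c u i : line_open D -> (forall w, D w -> f w = c) ->
  D u -> partial i f u = 0.
Proof.
move=> Dl fc Du; rewrite /partial derive_line.
have fc0 : \forall h \near (0 : R), c = f (h *: delta_mx 0 i + u).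
  by have := Dl u (delta_mx 0 i) Du; apply: filterS => h /fc.
have H := near_eq_is_derive fc0 (der_cst c 0).
exact: derive_val.
Qed.

(** Along the ray the first partial derivative is the derivative in r, so it only
    sees the values of f on the ray. *)
Lemma partial_radial f (p : R -> 'rV[R]_n.+1) (F : R -> R) (dF r : R) :
  (forall h : R, p (h + r) = h *: delta_mx 0 0 + p r) ->
  (forall s, 0 < s -> f (p s) = F s) -> 0 < r ->
  is_derive r 1 F dF -> partial 0 f (p r) = dF.
Proof.
move=> pE fF r0 FdF; rewrite /partial derive_line.
have H : is_derive (0 : R) 1 (fun h => F (h + r)) dF.
  have := @der_comp _ F (fun h => h + r) 0 dF _ _ (derD (der_id 0) (der_cst r 0)).
  by rewrite add0r addr0 mulr1; apply.
have fF0 : \forall h \near (0 : R), F (h + r) = f (h *: delta_mx 0 0 + p r).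
  have : \forall h \near (0 : R), - r < h by apply: lt_nbhsr; rewrite oppr_lt0.
  by apply: filterS => h hr; rewrite -pE fF// -ltrBlDr sub0r.
have {}H := near_eq_is_derive fF0 H.
exact: derive_val.
Qed.

Lemma sec_radial (G : 'rV[R]_n.+1 -> 'M[R]_n.+1) u (i : 'I_n.+1) :
  let v := delta_mx 0 i : 'rV[R]_n.+1 in
  let w := delta_mx 0 0 : 'rV[R]_n.+1 in
  sec G u v w = riem G i 0 0 i u / (G u i i * G u 0 0 - G u i 0 ^+ 2).
Proof.
move=> v w.
have bilE k l : bil (G u) (delta_mx 0 k) (delta_mx 0 l) = G u k l.
  by rewrite /bil -rowE trmx_delta -colE !mxE.
rewrite /sec /area2 !bilE; congr (_ / _).
rewrite (bigD1 i)//= [X in _ + X]big1 ?addr0 => [|j ji].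
rewrite (bigD1 0)//= [X in _ + X]big1 ?addr0 => [|j ji].
rewrite (bigD1 0)//= [X in _ + X]big1 ?addr0 => [|j ji].
rewrite (bigD1 i)//= [X in _ + X]big1 ?addr0 => [|j ji].
by rewrite !mxE !eqxx !mul1r.
by rewrite /v !mxE (negbTE ji) andbF mulr0 mul0r.
by rewrite big1// => l _; rewrite /w !mxE (negbTE ji) andbF !(mulr0, mul0r).
by rewrite big1// => l _; rewrite big1// => m _;
  rewrite /w !mxE (negbTE ji) andbF !(mulr0, mul0r).
by do 3 (rewrite big1// => ? _); rewrite /v !mxE (negbTE ji) andbF !mul0r.
Qed.

Lemma weyl_einstein_algebra (N b s : R) : N - 1 != 0 -> N != 0 ->
  - b * s - (b * - N + - N * b - 0 - 0) / (N + 1 - 2)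
    + - N * (N + 1) * (b - 0) / ((N + 1 - 1) * (N + 1 - 2)) = b * (1 - s).
Proof.
move=> N1 N0; have -> : N + 1 - 2 = N - 1 by ring.
have -> : N + 1 - 1 = N by ring.
by field; rewrite N1 N0.
Qed.

Lemma invmx_diag (d : 'rV[R]_n.+1) : (forall j, d 0 j != 0) ->
  invmx (diag_mx d) = diag_mx (\row_j (d 0 j)^-1).
Proof.
move=> d0; have E : diag_mx d *m diag_mx (\row_j (d 0 j)^-1) = 1%:M.
  rewrite mulmx_diag -[1%:M]diag_const_mx; congr diag_mx.
  by apply/rowP => j; rewrite !mxE divff.
have [U _] := mulmx1_unit E.
by rewrite -[LHS]mulmx1 -E mulmxA mulVmx// mul1mx.
Qed.

(** The metric G is in geodesic polar form on the region D, which contains the ray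
    p; on the ray it is diagonal, with entries a j whose half logarithmic
    derivative is g j. The angular block is unconstrained away from the ray. *)
Record diagonal_ray (G : 'rV[R]_n.+1 -> 'M[R]_n.+1) D
    (p : R -> 'rV[R]_n.+1) (a g dg : 'I_n.+1 -> R -> R) : Prop := DiagonalRay {
  ray_line_open : line_open D;
  ray_row0 : forall u, D u -> forall j, G u 0 j = (j == 0)%:R;
  ray_col0 : forall u, D u -> forall j, G u j 0 = (j == 0)%:R;
  ray_in : forall r : R, 0 < r -> D (p r);
  ray_shift : forall h r, p (h + r) = h *: delta_mx 0 0 + p r;
  ray_diag : forall r : R, 0 < r -> G (p r) = diag_mx (\row_j a j r);
  ray_gt0 : forall j (r : R), 0 < r -> 0 < a j r;
  ray_der : forall j (r : R), 0 < r -> is_derive r 1 (a j) (2 * g j r * a j r);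
  ray_der2 : forall j (r : R), 0 < r -> is_derive r 1 (g j) (dg j r) }.

Section Frame.
Variables (G : 'rV[R]_n.+1 -> 'M[R]_n.+1) (D : set 'rV[R]_n.+1)
  (p : R -> 'rV[R]_n.+1) (a g dg : 'I_n.+1 -> R -> R).
Hypothesis Gray : diagonal_ray G D p a g dg.

Let Dl := ray_line_open Gray.
Let G0r := ray_row0 Gray.
Let G0c := ray_col0 Gray.
Let pD := ray_in Gray.
Let pE := ray_shift Gray.
Let Gp := ray_diag Gray.
Let a0 := ray_gt0 Gray.
Let da := ray_der Gray.
Let dga := ray_der2 Gray.

Let partial_G0r u i j : D u -> partial i (fun w => G w 0 j) u = 0.
Proof. by move=> Du; apply: (partial_cst _ Dl (fun w Dw => G0r Dw j) Du). Qed.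

Let partial_G0c u i j : D u -> partial i (fun w => G w j 0) u = 0.
Proof. by move=> Du; apply: (partial_cst _ Dl (fun w Dw => G0c Dw j) Du). Qed.

Lemma G_diag r i j : 0 < r -> G (p r) i j = (i == j)%:R * a i r.
Proof. by move=> r0; rewrite Gp// !mxE mulr_natl. Qed.

Lemma invG_diag r i j : 0 < r -> invmx (G (p r)) i j = (i == j)%:R / a i r.
Proof.
move=> r0; rewrite Gp// invmx_diag; last by move=> k; rewrite mxE gt_eqF ?a0.
by rewrite !mxE mulr_natl.
Qed.

Lemma sum_invG r i (F : 'I_n.+1 -> R) : 0 < r ->
  \sum_s invmx (G (p r)) i s * F s = F i / a i r.
Proof.
move=> r0; rewrite (bigD1 i)//= big1 => [|s si]; rewrite invG_diag//.
  by rewrite eqxx addr0 mul1r mulrC.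
by rewrite eq_sym (negbTE si) !mul0r.
Qed.

Let partial0_G r i j : 0 < r ->
  partial 0 (fun w => G w i j) (p r) = (i == j)%:R * (2 * g i r * a i r).
Proof.
move=> r0; apply: (@partial_radial _ p (fun s => (i == j)%:R * a i s)) => //.
  by move=> s s0; rewrite G_diag.
apply: (der_eq (derM (der_cst _ r) (da i r0))).
by rewrite mul0r add0r.
Qed.

(** The lines in the direction of r are geodesics. *)
Lemma christoffel_radial u l : D u -> christoffel G l 0 0 u = 0.
Proof.
move=> Du; rewrite /christoffel big1 ?mulr0// => s _.
by rewrite !partial_G0r// addr0 subr0 mulr0.
Qed.

(** On the ray the second fundamental form of the distance spheres is diagonal:
    only radial derivatives of diagonal entries survive in these symbols. *)
Lemma christoffel_0r r l j : 0 < r ->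
  christoffel G l 0 j (p r) = (l == j)%:R * g l r.
Proof.
move=> r0; have Dp := pD r0; have al := a0 l r0.
rewrite /christoffel sum_invG// partial0_G// !partial_G0r//.
rewrite [j == l]eq_sym; have [<-|_] := eqVneq l j; rewrite /= ?(mulr1n, mulr0n).
  by field; rewrite gt_eqF.
by field; rewrite gt_eqF.
Qed.

Lemma christoffel_0c r l j : 0 < r ->
  christoffel G l j 0 (p r) = (l == j)%:R * g l r.
Proof.
move=> r0; have Dp := pD r0; have al := a0 l r0.
rewrite /christoffel sum_invG// partial0_G// partial_G0r// partial_G0c//.
rewrite [j == l]eq_sym; have [<-|_] := eqVneq l j; rewrite /= ?(mulr1n, mulr0n).
  by field; rewrite gt_eqF.
by field; rewrite gt_eqF.
Qed.

(** The Riccati equation. The term in which an angular derivative falls on a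
    Christoffel symbol is zero because these lines are geodesics throughout D, so
    the values of the metric on the ray suffice. *)
Lemma riem_up_radial r i : 0 < r ->
  riem_up G i 0 0 i (p r) = - (dg i r + g i r ^+ 2).
Proof.
move=> r0; have Dp := pD r0; rewrite /riem_up.
rewrite (partial_cst _ Dl (fun w => @christoffel_radial w i) Dp).
have chri s : 0 < s -> christoffel G i i 0 (p s) = g i s.
  by move=> s0; rewrite christoffel_0c// eqxx mul1r.
rewrite (partial_radial (fun h => pE h r) chri r0 (dga i r0)).
rewrite (bigD1 i)//= big1 => [|s si].
  by rewrite christoffel_radial// christoffel_0r// christoffel_0c// eqxx !mul1r; ring.
by rewrite christoffel_radial// christoffel_0r// eq_sym (negbTE si) mulr0 !mul0r subrr.
Qed.

Lemma riem_radial r i : 0 < r ->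
  riem G i 0 0 i (p r) = - a i r * (dg i r + g i r ^+ 2).
Proof.
move=> r0; rewrite /riem (bigD1 i)//= big1 => [|s si].
  by rewrite G_diag// eqxx riem_up_radial// mul1r; ring.
by rewrite G_diag// eq_sym (negbTE si) !mul0r.
Qed.

Lemma ric_radial r : 0 < r ->
  ric G 0 0 (p r) = - \sum_i (dg i r + g i r ^+ 2).
Proof.
by move=> r0; rewrite /ric -sumrN; apply: eq_bigr => i _; rewrite riem_up_radial.
Qed.

Lemma scal_einstein r : 0 < r ->
  (forall i j, ric G i j (p r) = - n%:R * G (p r) i j) ->
  scal G (p r) = - n%:R * n.+1%:R.
Proof.
move=> r0 E; rewrite /scal.
under eq_bigr do rewrite sum_invG// E G_diag// eqxx.
under eq_bigr => i _ do rewrite mul1r -mulrA divff ?mulr1 ?gt_eqF ?a0//.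
by rewrite sumr_const card_ord mulr_natr.
Qed.

Lemma a0E r : 0 < r -> a 0 r = 1.
Proof. by move=> r0; have := G0r (pD r0) 0; rewrite G_diag// eqxx mul1r. Qed.

Lemma weyl_radial r i : 0 < r -> (1 < n)%N -> i != 0 ->
  (forall i j, ric G i j (p r) = - n%:R * G (p r) i j) ->
  weyl G i 0 0 i (p r) = a i r * (1 - (dg i r + g i r ^+ 2)).
Proof.
move=> r0 n1 i0 E; rewrite /weyl riem_radial// !E scal_einstein//.
rewrite !G_diag// !eqxx a0E// (negbTE i0) eq_sym (negbTE i0).
have n2 : n%:R - 1 != 0 :> R by rewrite subr_eq0 pnatr_eq1 gtn_eqF.
have n3 : n%:R != 0 :> R by rewrite pnatr_eq0 gtn_eqF// ltnW.
rewrite -[n.+1%:R]natr1 !(mul1r, mulr1, mul0r, mulr0).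
exact: weyl_einstein_algebra.
Qed.

(** In a diagonal metric the squared norm is a sum of squares, one for each
    component, so it dominates each of them. *)
Lemma weyl_norm_ge r i j k l : 0 < r ->
  weyl G i j k l (p r) ^+ 2 <=
  a i r * a j r * a k r * a l r * weyl_norm G (p r) ^+ 2.
Proof.
move=> r0; pose W := fun i j k l => weyl G i j k l (p r).
pose T i j k l := W i j k l ^+ 2 / (a i r * a j r * a k r * a l r).
have aP m : 0 < a m r by exact: a0.
have aN m : a m r != 0 by rewrite gt_eqF.
have T0 i' j' k' l' : 0 <= T i' j' k' l'.
  by rewrite /T divr_ge0 ?sqr_ge0// ltW// !mulr_gt0.
have sumW x m (F : 'I_n.+1 -> R) :
    \sum_s x * invmx (G (p r)) m s * F s = x * (F m / a m r).
  by rewrite -sum_invG// mulr_sumr; apply: eq_bigr => s _; rewrite mulrA.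
have le_sum (F : 'I_n.+1 -> R) m : (forall m', 0 <= F m') -> F m <= \sum_m' F m'.
  by move=> F0; rewrite (bigD1 m)//= lerDl sumr_ge0.
have TE : \sum_i \sum_j \sum_k \sum_l \sum_a \sum_b \sum_c \sum_d
    invmx (G (p r)) i a * invmx (G (p r)) j b * invmx (G (p r)) k c
    * invmx (G (p r)) l d * W i j k l * W a b c d
    = \sum_i \sum_j \sum_k \sum_l T i j k l.
  do 4 (apply: eq_bigr => ? _).
  under eq_bigr => ? _.
    under eq_bigr => ? _.
      under eq_bigr => ? _.
        under eq_bigr => ? _ do rewrite -mulrA.
        rewrite sumW; over.
      rewrite sumW; over.
    rewrite sumW; over.
  under eq_bigr => m _ do rewrite -[invmx _ _ _]mul1r.
  by rewrite sumW /T; field; rewrite !aN.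
rewrite /weyl_norm -/(W i j k l) TE sqr_sqrtr; last first.
  by do 4 (apply: sumr_ge0 => ? _).
rewrite mulrC -ler_pdivrMr ?mulr_gt0// -/(T i j k l).
apply: le_trans (le_sum (fun i => \sum_j \sum_k \sum_l T i j k l) i _); last first.
  by move=> ?; do 3 (apply: sumr_ge0 => ? _).
apply: le_trans (le_sum (fun j => \sum_k \sum_l T i j k l) j _); last first.
  by move=> ?; do 2 (apply: sumr_ge0 => ? _).
apply: le_trans (le_sum (fun k => \sum_l T i j k l) k _); last first.
  by move=> ?; apply: sumr_ge0 => ? _.
exact: le_sum.
Qed.

(** The three geometric inputs, in terms of the radial sectional curvatures
    - (dg i + g i ^ 2): they are nonpositive, they differ from -1 by a component
    of the Weyl tensor, and the Einstein equation fixes their sum. *)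
Lemma frame_curvature r eps : 0 < r -> (1 < n)%N ->
  (forall i j, ric G i j (p r) = - n%:R * G (p r) i j) ->
  weyl_norm G (p r) <= eps ->
  (forall v w, area2 (G (p r)) v w != 0 -> sec G (p r) v w <= 0) ->
  (forall i, i != 0 ->
     0 <= dg i r + g i r ^+ 2 /\ `|dg i r + g i r ^+ 2 - 1| <= eps) /\
  \sum_i (dg i r + g i r ^+ 2) = n%:R.
Proof.
move=> r0 n1 E We S0; split; last first.
  apply: oppr_inj; rewrite -(ric_radial r0) E G_diag// eqxx a0E// !mulr1 //.
move=> i i0; have ai : 0 < a i r by exact: a0.
have aE : G (p r) i i * G (p r) 0 0 - G (p r) i 0 ^+ 2 = a i r.
  by rewrite !G_diag// !eqxx (negbTE i0) a0E// !mul1r mulr1 mul0r expr0n subr0.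
split.
  have := S0 (delta_mx 0 i) (delta_mx 0 0); rewrite sec_radial riem_radial// aE.
  have -> : area2 (G (p r)) (delta_mx 0 i) (delta_mx 0 0) = a i r.
    by rewrite -aE /area2 /bil -!rowE !trmx_delta -!colE !mxE.
  rewrite gt_eqF// => /(_ isT).
  by rewrite mulrAC mulNr divff ?gt_eqF// mulN1r oppr_le0.
have W0 : 0 <= weyl_norm G (p r) by exact: sqrtr_ge0.
have := weyl_norm_ge i 0 0 i r0; rewrite weyl_radial// a0E// !mulr1 -expr2 -exprMn.
have e0 : 0 <= eps by exact: le_trans We.
have aW : 0 <= a i r * weyl_norm G (p r) by rewrite mulr_ge0// ltW.
rewrite -[leLHS]real_normK ?num_real// ler_sqr ?nnegrE// normrM gtr0_norm//.
rewrite ler_pM2l// distrC => h.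
exact: le_trans We.
Qed.

End Frame.
End Polar.

(** * The variable x = exp (- r) *)

Section ChangeVar.
Context {R : realType}.

Lemma smooth1_der (f : R -> R) (k : nat) (x : R) : smooth1 f ->
  is_derive x 1 (derive1n k f) (derive1n k.+1 f x).
Proof. by move=> fs; have := derivableP (fs k x); rewrite -derive1E. Qed.

Lemma der_exp_slice (f : R -> R) (k : nat) (r : R) : smooth1 f ->
  is_derive r 1 (fun s => derive1n k f (expR (- s)))
    (- (expR (- r) * derive1n k.+1 f (expR (- r)))).
Proof.
move=> fs; apply: (der_eq (der_comp (smooth1_der k _ fs) (der_expN r))).
by rewrite mulrN mulrC.
Qed.

Lemma exp_slice_derive (y Y Y1 Y2 : R -> R) : smooth1 y ->
  (forall r : R, 0 < r -> y (expR (- r)) = Y r) ->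
  (forall r : R, 0 < r -> is_derive r 1 Y (Y1 r)) ->
  (forall r : R, 0 < r -> is_derive r 1 Y1 (Y2 r)) ->
  forall r : R, 0 < r -> let x := expR (- r) in
  derive1n 1 y x = - Y1 r / x /\ derive1n 2 y x = (Y1 r + Y2 r) / x ^+ 2.
Proof.
move=> ys yY dY dY1.
have E1 (r : R) : 0 < r -> Y1 r = - (expR (- r) * derive1n 1 y (expR (- r))).
  move=> r0; have H : \forall s \near r, Y s = y (expR (- s)).
    by apply: filterS (lt_nbhsr r0) => s /yY.
  exact: (der_unique (near_eq_is_derive H (dY r r0)) (der_exp_slice 0 r ys)).
move=> r r0 x; have x0 : x != 0 by rewrite gt_eqF// expR_gt0.
split; first by rewrite E1// -/x; field.
have H : \forall s \near r, Y1 s = - (expR (- s) * derive1n 1 y (expR (- s))).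
  by apply: filterS (lt_nbhsr r0) => s /E1.
have := der_unique (near_eq_is_derive H (dY1 r r0))
  (derN (derM (der_expN r) (der_exp_slice 1 r ys))).
by rewrite E1// -/x => ->; field.
Qed.

(** The estimates live on r > 0, that is x < 1; they reach x = 1 by continuity. *)
Lemma le_at1 (f g : R -> R) (delta : R) : delta < 1 ->
  {for 1, continuous f} -> {for 1, continuous g} ->
  (forall x, delta <= x < 1 -> `|f x| <= g x) -> `|f 1| <= g 1.
Proof.
move=> d1 cf cg fg.
have H : \forall x \near (1 : R)^'-, `|f x| <= g x.
  near=> x; apply: fg; apply/andP; split; last by near: x; exact: nbhs_left_lt.
  by near: x; apply: nbhs_left_ge.
have cf' : `|f x| @[x --> (1 : R)^'-] --> `|f 1|.
  by apply: cvg_norm; apply: cvg_at_left_filter; exact: cf.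
have cg' : g x @[x --> (1 : R)^'-] --> g 1.
  by apply: cvg_at_left_filter; exact: cg.
by apply: (ler_cvg_to cf' cg' H).
Unshelve. all: by end_near. Qed.

(** Decay of y at x = 1 in terms of its derivatives Y1 and Y2 in r = - ln x. The
    second bound is on Y1 + Y2 because x ^ 2 * y'' = Y1 + Y2. *)
Definition radial_decay (delta c : R) (k : nat) (y : R -> R) : Prop :=
  exists Y Y1 Y2 : R -> R,
  [/\ (forall r : R, 0 < r -> y (expR (- r)) = Y r),
      (forall r : R, 0 < r -> is_derive r 1 Y (Y1 r)),
      (forall r : R, 0 < r -> is_derive r 1 Y1 (Y2 r))
    & forall r : R, 0 < r -> delta <= expR (- r) ->
        `|Y1 r| <= c * r ^+ k.+1 /\ `|Y1 r + Y2 r| <= c * r ^+ k].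

Lemma radial_decay0 (delta c : R) (k : nat) (y : R -> R) : 0 <= c ->
  (forall x, 0 <= x <= 1 -> y x = 0) -> radial_decay delta c k y.
Proof.
move=> c0 y0; exists (fun=> 0), (fun=> 0), (fun=> 0).
split=> [r r0|r r0|r r0|r r0 _]; try exact: der_cst.
  by rewrite y0// expR_ge0/= expR_le1 oppr_le0 ltW.
by rewrite addr0 normr0; split; exact: (mulr_ge0 c0 (exprn_ge0 _ (ltW r0))).
Qed.

(** Since r = - ln x <= 1 / x - 1, powers of r are controlled by powers of
    1 - x ^ 2 when x >= delta. *)
Lemma radial_decay_bound (y : R -> R) (delta c : R) (k : nat) :
  smooth1 y -> 0 < delta < 1 -> 0 <= c -> radial_decay delta c k y ->
  forall x, delta <= x <= 1 ->
    `|derive1n 1 y x| <= c / delta ^+ k.+2 * (1 - x ^+ 2) ^+ k.+1 /\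
    `|derive1n 2 y x| <= c / delta ^+ k.+2 * (1 - x ^+ 2) ^+ k.
Proof.
move=> ys /andP[d0 d1] c0 [Y [Y1 [Y2 [yY dY dY1 YB]]]].
have main x : delta <= x < 1 ->
    `|derive1n 1 y x| <= c / delta ^+ k.+2 * (1 - x ^+ 2) ^+ k.+1 /\
    `|derive1n 2 y x| <= c / delta ^+ k.+2 * (1 - x ^+ 2) ^+ k.
  move=> /andP[dx x1]; have x0 : 0 < x by exact: lt_le_trans dx.
  pose r := - ln x; have xE : expR (- r) = x by rewrite opprK lnK.
  have r0 : 0 < r by rewrite oppr_gt0 ln_lt0// x0.
  have [e1 e2] := exp_slice_derive ys yY dY dY1 r0.
  have [b1 b2] : `|Y1 r| <= c * r ^+ k.+1 /\ `|Y1 r + Y2 r| <= c * r ^+ k.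
    by apply: YB; rewrite ?xE.
  rewrite xE in e1 e2.
  have rm : r <= (1 - x ^+ 2) / delta.
    have h1 : r <= x^-1 - 1.
      have := expR_ge1Dx r; have : expR r = x^-1 by rewrite -[r]opprK expRN xE.
      by lra.
    apply: (le_trans h1).
    have -> : x^-1 - 1 = (1 - x) / x by field; rewrite gt_eqF.
    apply: (@le_trans _ _ ((1 - x ^+ 2) / x)).
      by rewrite ler_pM2r ?invr_gt0//; nra.
    rewrite ler_pM2l ?lef_pV2//; nra.
  have m0 : 0 < 1 - x ^+ 2 by nra.
  have rk j : r ^+ j <= (1 - x ^+ 2) ^+ j / delta ^+ j.
    by rewrite -expr_div_n; apply: lerXn2r => //; rewrite nnegrE ltW// divr_gt0.
  have xd : x^-1 <= delta^-1 by rewrite lef_pV2.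
  rewrite e1 e2; split.
    have -> : c / delta ^+ k.+2 * (1 - x ^+ 2) ^+ k.+1
        = c * ((1 - x ^+ 2) ^+ k.+1 / delta ^+ k.+1) * delta^-1.
      by rewrite [delta ^+ k.+2]exprS invfM; ring.
    rewrite normrM normrN normfV (gtr0_norm x0); apply: ler_pM => //.
      by rewrite invr_ge0 ltW.
    by apply: (le_trans b1); rewrite ler_wpM2l.
  have -> : c / delta ^+ k.+2 * (1 - x ^+ 2) ^+ k
      = c * ((1 - x ^+ 2) ^+ k / delta ^+ k) * (delta^-1 ^+ 2).
    by rewrite [delta ^+ k.+2]exprSr exprSr !invfM; ring.
  rewrite normrM normfV normrX (gtr0_norm x0) -exprVn; apply: ler_pM => //.
  - by rewrite exprn_ge0// invr_ge0 ltW.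
  - by apply: (le_trans b2); rewrite ler_wpM2l.
  - by apply: lerXn2r => //; rewrite nnegrE invr_ge0 ltW.
have cont_m (B : R) j : {for 1, continuous (fun x : R => B * (1 - x ^+ 2) ^+ j)}.
  move=> x; apply: cvgM; first exact: cvg_cst.
  apply: (@continuous_comp _ _ _ (fun x : R => 1 - x ^+ 2) (fun z => z ^+ j)).
    by apply: cvgB; [exact: cvg_cst|exact: exprn_continuous].
  exact: exprn_continuous.
have cont_y j : {for 1, continuous (derive1n j y)}.
  exact: der_cont (smooth1_der j 1 ys).
move=> x /andP[dx]; rewrite le_eqVlt => /predU1P[->|x1]; last first.
  by apply: main; rewrite dx.
split.
  by apply: (le_at1 d1 (cont_y 1%N) (cont_m _ _)) => z /main[].
by apply: (le_at1 d1 (cont_y 2%N) (cont_m _ _)) => z /main[].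
Qed.

End ChangeVar.

(** * Logarithmic derivatives of the metric coefficients *)

Section LogDerivative.
Context {R : realType}.
Variable f : R -> R.
Hypotheses (fs : smooth1 f) (f0 : forall x, 0 <= x <= 1 -> 0 < f x).
Implicit Type r : R.

(** Half the derivative in r of ln (f (exp (- r))). *)
Definition half_dlog r : R :=
  - (expR (- r) * derive1n 1 f (expR (- r))) / (2 * f (expR (- r))).

Definition half_ddlog r : R :=
  (expR (- r) * derive1n 1 f (expR (- r))
   + expR (- r) ^+ 2 * derive1n 2 f (expR (- r))) / (2 * f (expR (- r)))
  - (expR (- r) * derive1n 1 f (expR (- r))) ^+ 2 / (2 * f (expR (- r)) ^+ 2).

(** Minus one minus the radial sectional curvature of
    dr ^ 2 + sinh r ^ 2 * f (exp (- r)) dtheta ^ 2. *)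
Definition curv_defect r : R :=
  half_ddlog r + half_dlog r ^+ 2 + 2 * (cosh r / sinh r) * half_dlog r.

Lemma slice_gt0 r : 0 <= r -> 0 < f (expR (- r)).
Proof. by move=> r0; rewrite f0// expR_ge0/= expR_le1 oppr_le0. Qed.

Lemma der_half_dlog r : 0 <= r -> is_derive r 1 half_dlog (half_ddlog r).
Proof.
move=> r0; have F0 := slice_gt0 r0; rewrite /half_dlog.
apply: (der_eq (derM (derN (derM (der_expN r) (der_exp_slice 1 r fs)))
  (derV _ (derM (der_cst 2 r) (der_exp_slice 0 r fs))))).
  by rewrite mulf_neq0// gt_eqF.
by rewrite /half_ddlog /=; field; rewrite gt_eqF.
Qed.

Lemma der_ln_slice r : 0 <= r ->
  is_derive r 1 (fun s => ln (f (expR (- s)))) (2 * half_dlog r).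
Proof.
move=> r0; have F0 := slice_gt0 r0.
apply: (der_eq (der_comp (is_derive1_ln F0) (der_exp_slice 0 r fs))).
by rewrite /half_dlog /=; field; rewrite gt_eqF.
Qed.

Lemma der_sqrt_slice r : 0 <= r ->
  is_derive r 1 (fun s => Num.sqrt (f (expR (- s))))
    (half_dlog r * Num.sqrt (f (expR (- r)))).
Proof.
move=> r0; have F0 := slice_gt0 r0.
apply: (der_eq (der_comp (is_derive1_sqrt F0) (der_exp_slice 0 r fs))).
have s0 : 0 < Num.sqrt (f (expR (- r))) by rewrite sqrtr_gt0.
move: (Num.sqrt _) s0 (sqr_sqrtr (ltW F0)) => s s0 sE.
by rewrite /half_dlog -sE /=; field; rewrite gt_eqF.
Qed.

Lemma der_sinh2_slice r : 0 < r ->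
  is_derive r 1 (fun s => sinh s ^+ 2 * f (expR (- s)))
    (2 * (cosh r / sinh r + half_dlog r) * (sinh r ^+ 2 * f (expR (- r)))).
Proof.
move=> r0; have F0 := slice_gt0 (ltW r0); have S0 := sinh_gt0 r0.
apply: (der_eq (derM (derM (der_sinh r) (der_sinh r)) (der_exp_slice 0 r fs))).
by rewrite /half_dlog /=; field; rewrite !gt_eqF.
Qed.

Lemma der_coth_half_dlog r : 0 < r ->
  is_derive r 1 (fun s => cosh s / sinh s + half_dlog s)
    (1 - (cosh r / sinh r) ^+ 2 + half_ddlog r).
Proof.
move=> r0; have S0 := sinh_gt0 r0; have S1 : sinh r != 0 by rewrite gt_eqF.
apply: (der_eq (derD (derM (der_cosh r) (derV S1 (der_sinh r)))
  (der_half_dlog (ltW r0)))).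
by field.
Qed.

Lemma curv_defectE r :
  1 - (cosh r / sinh r) ^+ 2 + half_ddlog r + (cosh r / sinh r + half_dlog r) ^+ 2
  = 1 + curv_defect r.
Proof. by rewrite /curv_defect; ring. Qed.

(** The weight E of the comparison is the square root of f (exp (- r)), so that
    sinh * E is the length of the Jacobi field. *)
Lemma half_dlog_bound (eps : R) :
  (forall r, 0 < r -> -1 <= curv_defect r /\ `|curv_defect r| <= eps) ->
  forall r, 0 < r -> `|half_dlog r| <= eps * r.
Proof.
move=> H; apply: (riccati_bound _ der_sqrt_slice der_half_dlog H) => r r0.
by rewrite sqrtr_gt0 slice_gt0.
Qed.

End LogDerivative.

Lemma half_ddlog_bound (R : realType) (f : R -> R) (eps delta r : R) :
  0 < delta -> 0 < r ->
  delta <= expR (- r) ->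
  `|curv_defect f r| <= eps -> `|half_dlog f r| <= eps * r ->
  `|half_ddlog f r| <= eps + (eps * r) ^+ 2 + 2 * (eps / delta).
Proof.
move=> d0 r0 dr w u.
have -> : half_ddlog f r = curv_defect f r - half_dlog f r ^+ 2
    - 2 * (cosh r / sinh r * half_dlog f r).
  by rewrite /curv_defect; ring.
have c0 : 0 < cosh r / sinh r by exact: divr_gt0 (cosh_gt0 r) (sinh_gt0 r0).
have e0 : 0 <= eps by apply: le_trans w.
have cu : `|cosh r / sinh r * half_dlog f r| <= eps / delta.
  rewrite normrM gtr0_norm//; apply: (@le_trans _ _ (cosh r / sinh r * (eps * r))).
    by rewrite ler_pM2l.
  rewrite mulrCA ler_wpM2l// mulrC.
  apply: le_trans (coth_le r0) _.
  by rewrite -[r]opprK expRN lef_pV2 ?posrE ?expR_gt0.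
have u2 : `|half_dlog f r ^+ 2| <= (eps * r) ^+ 2.
  by rewrite normrX; apply: lerXn2r; rewrite ?nnegrE// mulr_ge0// ltW.
apply: le_trans (ler_normB _ _) _; rewrite normrM (gtr0_norm (ltr0n _ 2)).
apply: lerD; last by rewrite ler_pM2l.
by apply: le_trans (ler_normB _ _) _; apply: lerD.
Qed.

(** * Curvature of a metric in polar form *)

Section PolarForm.
Context {R : realType} {n : nat}.

Lemma cvg_line (V : normedModType R) (v u : V) :
  h *: v + u @[h --> (0 : R)] --> u.
Proof.
rewrite -[X in _ --> X]add0r -(scale0r v); apply: cvgD; last exact: cvg_cst.
by apply: cvgZr_tmp; exact: cvg_id.
Qed.

Lemma lift0_mx00 (B : 'M[R]_n) : lift0_mx B 0 0 = 1.
Proof.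
have -> : 0 = lshift n 0 :> 'I_(1 + n) by apply: val_inj.
by rewrite /lift0_mx block_mxEul mxE.
Qed.

Lemma lift0_mx0r (B : 'M[R]_n) j : lift0_mx B 0 (lift ord0 j) = 0.
Proof.
have -> : 0 = lshift n 0 :> 'I_(1 + n) by apply: val_inj.
have -> : lift ord0 j = rshift 1 j :> 'I_(1 + n) by apply: val_inj.
by rewrite /lift0_mx block_mxEur mxE.
Qed.

Lemma lift0_mxr0 (B : 'M[R]_n) i : lift0_mx B (lift ord0 i) 0 = 0.
Proof.
have -> : 0 = lshift n 0 :> 'I_(1 + n) by apply: val_inj.
have -> : lift ord0 i = rshift 1 i :> 'I_(1 + n) by apply: val_inj.
by rewrite /lift0_mx block_mxEdl mxE.
Qed.

Lemma lift0_mxrr (B : 'M[R]_n) i j :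
  lift0_mx B (lift ord0 i) (lift ord0 j) = B i j.
Proof.
have -> : lift ord0 i = rshift 1 i :> 'I_(1 + n) by apply: val_inj.
have -> : lift ord0 j = rshift 1 j :> 'I_(1 + n) by apply: val_inj.
by rewrite /lift0_mx block_mxEdr.
Qed.

Definition polar_region (V : set 'rV[R]_n) : set 'rV[R]_n.+1 :=
  [set u : 'rV[R]_n.+1 | 0 < u 0 ord0 /\ V (@rsubmx R 1 1 n u)].

Lemma polar_region_line_open V : open V -> line_open (polar_region V).
Proof.
move=> oV u v [u0 Vu].
have H1 : \forall h \near (0 : R), 0 < h *: v 0 ord0 + u 0 ord0.
  exact: (@cvg_line R^o (v 0 ord0) (u 0 ord0) _ (lt_nbhsr u0)).
have H2 : \forall h \near (0 : R), V (h *: @rsubmx R 1 1 n v + @rsubmx R 1 1 n u).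
  exact: (cvg_line (@rsubmx R 1 1 n v) (open_nbhs_nbhs (conj oV Vu))).
near=> h; split.
  by rewrite !mxE; near: h; exact: H1.
by rewrite linearD linearZ /=; near: h; exact: H2.
Unshelve. all: by end_near. Qed.

Definition axis (th : 'rV[R]_n) (r : R) : 'rV[R]_n.+1 := @row_mx R 1 1 n r%:M th.

Lemma axisE th h r : axis th (h + r) = h *: delta_mx 0 0 + axis th r.
Proof.
apply/rowP => j; rewrite !mxE.
case: splitP => k jk.
  have -> : j == 0 by rewrite -val_eqE /= jk (ord1 k).
  by rewrite (ord1 k) !mxE eqxx mulr1.
have -> : (j == 0) = false by rewrite -val_eqE /= jk.
by rewrite andbF mulr0 add0r.
Qed.

Lemma axis0 th r : axis th r 0 0 = r.
Proof.
rewrite /axis mxE; case: splitP => k //= _.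
by rewrite (ord1 k) mxE eqxx.
Qed.

Lemma lift0_diag (d : 'rV[R]_n) : lift0_mx (diag_mx d) =
  diag_mx (\row_j (if unlift 0 j is Some i then d 0 i else 1) : 'rV[R]_n.+1).
Proof.
apply/matrixP => i j; rewrite [in RHS]mxE [in RHS]mxE.
case: (unliftP 0 i) => [i'|] ->; case: (unliftP 0 j) => [j'|] ->.
- by rewrite lift0_mxrr mxE (inj_eq lift_inj).
- by rewrite lift0_mxr0.
- by rewrite lift0_mx0r.
- by rewrite lift0_mx00.
Qed.

(** On the ray to q the polar form is diagonal for every r, so all its radial
    curvatures can be read off from the coefficients I_i. *)
Lemma polar_curvature (X : topologicalType) (A : set (chart R n X))
    (g : chart R n X -> 'rV[R]_n.+1 -> 'M[R]_n.+1) (phi : 'rV[R]_n.+1 -> X)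
    (q : 'rV[R]_n.+1) (e : 'M[R]_(n, n.+1)) (p0 : X) (Ifun : 'I_4 -> R -> R)
    (eps : R) : (1 < n)%N -> einstein A g -> nonpositively_curved A g ->
  weyl_bound A g eps -> polar_form A g phi q e p0 Ifun ->
  (forall b, smooth1 (Ifun b)) ->
  (forall b x, 0 <= x <= 1 -> 0 < Ifun b x) ->
  forall r : R, 0 < r ->
  (forall i : 'I_n, -1 <= curv_defect (Ifun (wt i)) r /\
                    `|curv_defect (Ifun (wt i)) r| <= eps) /\
  \sum_(i < n) curv_defect (Ifun (wt i)) r = 0.
Proof.
move=> n1 gE gS gW [ray] [c] [V] [Th] [th0] [hbar].
case=> _ [oV Vth0 _ _ _] [Ac imc _] gc hdiag Is I0 r r0.
have imD u : polar_region V u -> Defs.image c u by rewrite imc.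
have intD u : polar_region V u -> int_image c u.
  by move=> Vu; split; [exact: imD|case: Vu].
have axD (s : R) : 0 < s -> polar_region V (axis th0 s).
  by move=> s0; split; [rewrite axis0|rewrite /axis row_mxKr].
pose a (j : 'I_n.+1) s := if unlift 0 j is Some i
  then sinh s ^+ 2 * Ifun (wt i) (expR (- s)) else 1.
pose h (j : 'I_n.+1) s := if unlift 0 j is Some i
  then cosh s / sinh s + half_dlog (Ifun (wt i)) s else 0.
pose dh (j : 'I_n.+1) s := if unlift 0 j is Some i
  then 1 - (cosh s / sinh s) ^+ 2 + half_ddlog (Ifun (wt i)) s else 0.
have G0r u : polar_region V u -> forall j, g c u 0 j = (j == 0)%:R.
  move=> Vu j; rewrite (gc _ (imD _ Vu)).
  by case: (unliftP 0 j) => [j'|] ->; [rewrite lift0_mx0r|rewrite lift0_mx00].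
have G0c u : polar_region V u -> forall j, g c u j 0 = (j == 0)%:R.
  move=> Vu j; rewrite (gc _ (imD _ Vu)).
  by case: (unliftP 0 j) => [j'|] ->; [rewrite lift0_mxr0|rewrite lift0_mx00].
have Gp (s : R) : 0 < s -> g c (axis th0 s) = diag_mx (\row_j a j s).
  move=> s0; rewrite (gc _ (imD _ (axD s s0))) axis0 /axis row_mxKr hdiag//.
  rewrite -linearZ lift0_diag; congr diag_mx; apply/rowP => j.
  by rewrite !mxE /a; case: (unlift 0 j) => // i; rewrite !mxE.
have a0 j (s : R) : 0 < s -> 0 < a j s.
  move=> s0; rewrite /a; case: (unlift 0 j) => // i.
  exact: (mulr_gt0 (exprn_gt0 2 (sinh_gt0 s0)) (slice_gt0 (I0 _) (ltW s0))).
have da j (s : R) : 0 < s -> is_derive s 1 (a j) (2 * h j s * a j s).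
  move=> s0; rewrite /a /h; case: (unlift 0 j) => [i|].
    exact: (der_sinh2_slice (Is _) (I0 _) s0).
  by apply: (der_eq (der_cst 1 s)); rewrite mulr0 mul0r.
have dha j (s : R) : 0 < s -> is_derive s 1 (h j) (dh j s).
  move=> s0; rewrite /h /dh; case: (unlift 0 j) => [i|].
    exact: (der_coth_half_dlog (Is _) (I0 _) s0).
  exact: der_cst.
have intr := intD _ (axD r r0).
have F := DiagonalRay (polar_region_line_open oV) G0r G0c axD (axisE th0) Gp a0
  da dha.
have [k1 k2] := frame_curvature F r0 n1 (fun i j => gE c _ i j Ac intr)
  (gW c _ Ac intr) (fun v w => gS c _ v w Ac intr).
have kE i : dh (lift 0 i) r + h (lift 0 i) r ^+ 2
    = 1 + curv_defect (Ifun (wt i)) r.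
  by rewrite /h /dh liftK curv_defectE.
split.
  move=> i; have [] := k1 (lift 0 i) isT.
  by rewrite kE => k10 k11; split; [lra|move: k11; rewrite addrAC subrr add0r].
move: k2; rewrite big_ord_recl /h /dh unlift_none expr0n !add0r /=.
under eq_bigr => i _ do rewrite liftK curv_defectE.
rewrite big_split /= sumr_const card_ord => kS.
by apply: (addrI n%:R); rewrite kS addr0.
Qed.

End PolarForm.

(** * Decay of the associated functions *)

Section Weights.
Context {R : realType} {n : nat}.

Lemma sum_wt (F : 'I_4 -> R) (m : nat) :
  \sum_(i < 3 + m) F (wt i) =
  \sum_(i < 3) F (widen_ord (leqnSn 3) i) + m%:R * F ord_max.
Proof.
rewrite big_split_ord /=; congr (_ + _).
  apply: eq_bigr => i _; congr F; apply: val_inj.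
  rewrite /wt /= inordK ?ltnS ?geq_minr//; apply/minn_idPl.
  exact: (ltnW (ltn_ord i)).
rewrite mulr_natl -[m in RHS]card_ord -sumr_const; apply: eq_bigr => i _; congr F.
apply: val_inj.
by rewrite /wt /= inordK ?ltnS ?geq_minr//; apply/minn_idPr; exact: leq_addr.
Qed.

Lemma ln_prod_wt (a : 'I_4 -> R) : (3 <= n)%N ->
  (forall b, 0 < a b) ->
  ln (\prod_(i < 3) a (widen_ord (leqnSn 3) i) * a ord_max ^+ (n - 3)) =
  \sum_(i < n) ln (a (wt i)).
Proof.
move=> n3 a0; have S : \sum_(i < n) ln (a (wt i)) =
    \sum_(i < 3) ln (a (widen_ord (leqnSn 3) i)) + (n - 3)%:R * ln (a ord_max).
  move: (subnKC n3); move: (n - 3)%N => m E; subst n.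
  exact: (sum_wt (fun b => ln (a b))).
rewrite S lnM ?posrE ?prodr_gt0 ?exprn_gt0// lnXn// mulr_natl; congr (_ + _).
by rewrite !big_ord_recl !big_ord0 mulr1 addr0 !lnM ?posrE ?mulr_gt0.
Qed.

End Weights.

Section SphereEstimates.
Context {R : realType} {n : nat}.
Variables (I : 'I_4 -> R -> R) (eps delta : R).
Hypotheses (n3 : (3 < n)%N) (Is : forall b, smooth1 (I b))
  (I0 : forall b x, 0 <= x <= 1 -> 0 < I b x) (d01 : 0 < delta < 1).
Hypothesis curvI : forall r : R, 0 < r ->
  (forall i : 'I_n, -1 <= curv_defect (I (wt i)) r /\
                    `|curv_defect (I (wt i)) r| <= eps) /\
  \sum_(i < n) curv_defect (I (wt i)) r = 0.

Lemma wt_surj (b : 'I_4) : exists i : 'I_n, wt i = b.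
Proof.
have bn : (b < n)%N by apply: leq_trans n3; rewrite ltn_ord.
exists (Ordinal bn); apply: val_inj; rewrite /wt /= inordK ?ltnS ?geq_minr//.
by apply/minn_idPl; rewrite -ltnS ltn_ord.
Qed.

Lemma curvI_bound b (r : R) : 0 < r ->
  -1 <= curv_defect (I b) r /\ `|curv_defect (I b) r| <= eps.
Proof. by move=> r0; have [i <-] := wt_surj b; have [h _] := curvI r0. Qed.

Lemma dlogI_bound b (r : R) : 0 < r -> `|half_dlog (I b) r| <= eps * r.
Proof. by move=> r0; exact: (half_dlog_bound (@Is b) (I0 b) (curvI_bound b) r0). Qed.

(** The defects sum to zero by the Einstein equation, which leaves the squares of
    the half_dlog, already of size eps ^ 2 * r ^ 2, to drive the trace. *)
Lemma dlog_trace_bound (r : R) : 0 < r ->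
  `|\sum_(i < n) half_dlog (I (wt i)) r| <= n%:R * eps ^+ 2 * r ^+ 3 /\
  (delta <= expR (- r) -> `|\sum_(i < n) half_ddlog (I (wt i)) r| <=
     n%:R * eps ^+ 2 * r ^+ 2 * (1 + 2 / delta)).
Proof.
have /andP[d0 d1] := d01.
pose U s := \sum_(i < n) half_dlog (I (wt i)) s.
pose dU s := \sum_(i < n) half_ddlog (I (wt i)) s.
pose S s := \sum_(i < n) half_dlog (I (wt i)) s ^+ 2.
have UE (s : R) : 0 < s -> dU s + 2 * (cosh s / sinh s) * U s = - S s.
  move=> s0; have [_ w0] := curvI s0.
  rewrite -[RHS]add0r -w0 -sumrB /dU /U mulr_sumr -big_split /=.
  by apply: eq_bigr => i _; rewrite /curv_defect; ring.
have SB (s : R) : 0 < s -> 0 <= S s <= n%:R * eps ^+ 2 * s ^+ 2.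
  move=> s0; rewrite sumr_ge0/=; last by move=> i _; exact: sqr_ge0.
  rewrite -mulrA -exprMn mulr_natl -[n in leRHS]card_ord -sumr_const.
  apply: ler_sum => i _; rewrite -[leLHS]real_normK ?num_real//.
  have h := dlogI_bound (wt i) s0.
  by apply: lerXn2r => //; rewrite nnegrE// (le_trans _ h).
have UB := riccati_trace_bound (fun s s0 => der_sum (fun i : 'I_n =>
  der_half_dlog (@Is (wt i)) (I0 (wt i)) s0)) UE SB.
move=> r0; split; first exact: UB.
move=> dr; have c0 : 0 < cosh r / sinh r.
  exact: divr_gt0 (cosh_gt0 r) (sinh_gt0 r0).
have ec : r * (cosh r / sinh r) <= delta^-1.
  apply: le_trans (coth_le r0) _.
  by rewrite -[r]opprK expRN lef_pV2 ?posrE ?expR_gt0.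
have -> : \sum_(i < n) half_ddlog (I (wt i)) r = - S r - 2 * (cosh r / sinh r * U r).
  by rewrite -UE// -/(dU r); ring.
have B0 : 0 <= n%:R * eps ^+ 2 * r ^+ 2.
  by have /andP[? ?] := SB r r0; apply: le_trans (_ : S r <= _).
have cU : `|cosh r / sinh r * U r| <= n%:R * eps ^+ 2 * r ^+ 2 / delta.
  rewrite normrM gtr0_norm//.
  apply: (@le_trans _ _ (cosh r / sinh r * (n%:R * eps ^+ 2 * r ^+ 3))).
    by rewrite ler_pM2l// UB.
  have -> : cosh r / sinh r * (n%:R * eps ^+ 2 * r ^+ 3)
      = n%:R * eps ^+ 2 * r ^+ 2 * (r * (cosh r / sinh r)) by ring.
  by rewrite ler_wpM2l.
apply: le_trans (ler_normB _ _) _; rewrite normrN normrM (gtr0_norm (ltr0n _ 2)).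
have /andP[S0 S1] := SB r r0; rewrite (ger0_norm S0).
have -> : n%:R * eps ^+ 2 * r ^+ 2 * (1 + 2 / delta)
  = n%:R * eps ^+ 2 * r ^+ 2 + 2 * (n%:R * eps ^+ 2 * r ^+ 2 / delta) by ring.
by apply: lerD => //; rewrite ler_pM2l.
Qed.

Let D := delta^-1.

Let D0 : 0 < D.
Proof. by have /andP[? _] := d01; rewrite invr_gt0. Qed.

Let slice01 (r : R) : 0 < r -> 0 <= expR (- r) <= 1.
Proof. by move=> r0; rewrite expR_ge0/= expR_le1 oppr_le0 ltW. Qed.

Let slice_le (r : R) : delta <= expR (- r) -> r <= D.
Proof.
have /andP[d0 _] := d01 => dr; have h : expR r <= D.
  by rewrite -[r]opprK expRN lef_pV2 ?posrE ?expR_gt0.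
by apply: le_trans h; apply: le_trans (expR_ge1Dx r); lra.
Qed.

(** ln K is the sum of the logarithms of all n coefficients. *)
Lemma trace_decay (y : R -> R) :
  (forall x, 0 <= x <= 1 -> y x =
     ln (\prod_(i < 3) I (widen_ord (leqnSn 3) i) x * I ord_max x ^+ (n - 3))) ->
  radial_decay delta (2 * n%:R * (1 + 3 * D) * eps ^+ 2) 2 y.
Proof.
move=> yE; have ee : 0 <= eps ^+ 2 by exact: sqr_ge0.
exists (fun r => \sum_(i < n) ln (I (wt i) (expR (- r)))),
  (fun r => \sum_(i < n) 2 * half_dlog (I (wt i)) r),
  (fun r => \sum_(i < n) (0 * half_dlog (I (wt i)) r
                          + 2 * half_ddlog (I (wt i)) r)).
split=> [r r0|r r0|r r0|r r0 dr].
- rewrite yE ?slice01// (ln_prod_wt (a := fun b => I b (expR (- r)))) ?(ltnW n3)//.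
  by move=> b; exact: I0 (slice01 r0).
- by apply: der_sum => i; apply: (der_ln_slice (@Is _) (I0 _) (ltW r0)).
- apply: der_sum => i.
  exact: derM (der_cst _ _) (der_half_dlog (@Is _) (I0 _) (ltW r0)).
have [U1 /(_ dr) U2] := dlog_trace_bound r0.
have r_D := slice_le dr.
rewrite big_split /= -!mulr_sumr mul0r add0r; set U := \sum_(_ < _) _ in U1 *.
set dU := \sum_(_ < _) _ in U2 *.
have N0 : 0 <= n%:R :> R by exact: ler0n.
pose M := n%:R * eps ^+ 2 * r ^+ 2.
have M0 : 0 <= M by exact: (mulr_ge0 (mulr_ge0 N0 ee) (exprn_ge0 _ (ltW r0))).
have {}U1 : `|U| <= M * r by apply: le_trans U1 _; rewrite /M; lra.
have MD : M * r <= M * D by rewrite ler_wpM2l.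
have {}U2 : `|dU| <= M * (1 + 2 * D) by [].
have norm2 (z : R) : `|2 * z| = 2 * `|z| by rewrite normrM gtr0_norm.
split.
  have -> : 2 * n%:R * (1 + 3 * D) * eps ^+ 2 * r ^+ 3
      = 2 * (M * r * (1 + 3 * D)) by rewrite /M; ring.
  rewrite norm2 ler_pM2l//; apply: (le_trans U1).
  by apply: ler_peMr; [exact: mulr_ge0 M0 (ltW r0)|lra].
have -> : 2 * n%:R * (1 + 3 * D) * eps ^+ 2 * r ^+ 2 = 2 * (M * (1 + 3 * D)).
  by rewrite /M; ring.
rewrite -mulrDr norm2 ler_pM2l//; apply: (le_trans (ler_normD _ _)).
by apply: (le_trans (lerD U1 U2)); lra.
Qed.

(** The bound T on eps absorbs the quadratic term (eps * r) ^ 2 of the Riccati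
    equation into a multiple of eps. *)
Lemma ratio_decay (T : R) (c : 'I_4) (y : R -> R) : 0 <= eps <= T ->
  (forall x, 0 <= x <= 1 -> y x = ln (I c x / I ord_max x)) ->
  radial_decay delta (4 * (1 + T * D ^+ 2 + 3 * D) * eps) 0 y.
Proof.
move=> /andP[e0 eT] yE; have /andP[d0 _] := d01.
exists (fun r => ln (I c (expR (- r))) - ln (I ord_max (expR (- r)))),
  (fun r => 2 * half_dlog (I c) r - 2 * half_dlog (I ord_max) r),
  (fun r => (0 * half_dlog (I c) r + 2 * half_ddlog (I c) r)
     - (0 * half_dlog (I ord_max) r + 2 * half_ddlog (I ord_max) r)).
split=> [r r0|r r0|r r0|r r0 dr].
- by rewrite yE ?slice01// ln_div// posrE I0// slice01.
- by apply: derD; [|apply: derN];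
    apply: (der_ln_slice (@Is _) (I0 _) (ltW r0)).
- by apply: derD; [|apply: derN];
    apply: derM (der_cst _ _) (der_half_dlog (@Is _) (I0 _) (ltW r0)).
have u_ b : `|half_dlog (I b) r| <= eps * r by exact: dlogI_bound.
have er : 0 <= eps * r by rewrite mulr_ge0// ltW.
have erD : eps * r <= eps * D by rewrite ler_wpM2l// slice_le.
have T0 : 0 <= T by exact: le_trans eT.
have D2 : 0 <= T * D ^+ 2 by rewrite mulr_ge0// exprn_ge0// ltW.
have du_ b : `|half_ddlog (I b) r| <= eps * (1 + T * D ^+ 2 + 2 * D).
  have [_ wb] := curvI_bound b r0.
  apply: le_trans (half_ddlog_bound d0 r0 dr wb (u_ b)) _; rewrite -/D.
  have : (eps * r) ^+ 2 <= eps * (T * D ^+ 2).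
    rewrite exprMn expr2 -mulrA ler_wpM2l//; apply: ler_pM => //.
      by rewrite exprn_ge0// (ltW r0).
    by apply: lerXn2r; rewrite ?nnegrE ?(ltW r0) ?(ltW D0)//; exact: slice_le.
  by lra.
have norm2B (v w z : R) : `|v| <= z -> `|w| <= z -> `|2 * v - 2 * w| <= 4 * z.
  by rewrite !ler_norml => /andP[? ?] /andP[? ?]; apply/andP; split; lra.
have u2 := norm2B _ _ _ (u_ c) (u_ ord_max).
have du2 := norm2B _ _ _ (du_ c) (du_ ord_max).
rewrite !mul0r !add0r expr1 expr0 mulr1; split.
  apply: (le_trans u2).
  have -> : 4 * (1 + T * D ^+ 2 + 3 * D) * eps * r
      = 4 * (eps * r * (1 + (T * D ^+ 2 + 3 * D))) by ring.
  rewrite ler_pM2l//; apply: ler_peMr => //.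
  by rewrite lerDl addr_ge0// mulr_ge0// ltW.
by apply: (le_trans (ler_normD _ _)); apply: (le_trans (lerD u2 du2)); lra.
Qed.

End SphereEstimates.

Theorem lemma3p4 (R : realType) (k n : nat) (hk : (1 <= k)%N)
    (hn : n = (4 * k + 3)%N) (sigma tau delta0 : R)
    (hsigma : 0 < sigma < 1) (htau : 0 < tau) (hdelta0 : 0 < delta0 < 1) :
  exists2 C : R, 0 < C &
  forall (X : topologicalType) (A : set (chart R n X))
    (g : chart R n X -> 'rV[R]_n.+1 -> 'M[R]_n.+1)
    (ghat : 'rV[R]_n.+1 -> 'M[R]_n.+1) (q : 'rV[R]_n.+1)
    (e : 'M[R]_(n, n.+1)) (lambda : 'I_4 -> R)
    (phi : 'rV[R]_n.+1 -> X) (y : 'I_4 -> R -> R) (eps : R),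
  let t := fun (i : 'I_3) (x : R) => expR (y (lift ord0 i) x) in
  let t1 := t 0 0 in let t2 := t 1 0 in let t3 := t 2 0 in
  CCE A g -> @simply_connected R X (mint A) -> nonpositively_curved A g ->
  homogeneous_metric ghat q e lambda ->
  conformal_infinity A g ghat phi ->
  associated_functions A g phi q e y ->
  (forall i : 'I_3, sigma < t i 0 < (n%:R + 5) / 3) ->
  t1 >= t2 -> t2 >= t3 ->
  (forall i j l : 'I_3, i != j -> i != l -> j != l ->
     (t i 0)^-1 * (t j 0 + t l 0) > 1) ->
  (forall C13 C23 : R, 1 <= C13 <= t1 / t3 -> 1 <= C23 <= t2 / t3 ->
     2 * C13 * C23 + 2 * C13 + 2 * C23 - C13 ^+ 2 - C23 ^+ 2 - 1 > tau) ->
  0 < eps <= Num.sqrt (n%:R * (n%:R ^+ 2 - 1)) ->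
  weyl_bound A g eps ->
  forall (d : nat) (x : R), (1 <= d <= 2)%N -> delta0 <= x <= 1 ->
    `|derive1n d (y ord0) x| <= C * eps ^+ 2 * (1 - x ^+ 2) ^+ (4 - d) /\
    forall i : 'I_3,
      `|derive1n d (y (lift ord0 i)) x| <= C * eps * (1 - x ^+ 2) ^+ (2 - d).
Proof.
have /andP[d0 _] := hdelta0; set D := delta0^-1.
have D0 : 0 < D by rewrite invr_gt0.
have n3 : (3 < n)%N.
  by rewrite hn -[(4 * k)%N]prednK ?muln_gt0 ?hk// addSn ltnS leq_addl.
set T := Num.sqrt (n%:R * (n%:R ^+ 2 - 1)).
pose Ctr : R := 2 * n%:R * (1 + 3 * D); pose Cfree := 4 * (1 + T * D ^+ 2 + 3 * D).
have Ctr0 : 0 <= Ctr.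
  by rewrite /Ctr mulr_ge0// ?mulr_ge0//; lra.
have Cfree0 : 0 < Cfree.
  have TD : 0 <= T * D ^+ 2 by rewrite mulr_ge0 ?sqrtr_ge0// exprn_ge0// ltW.
  by rewrite /Cfree; lra.
have CD4 : 0 <= Ctr * D ^+ 4 by rewrite mulr_ge0// exprn_ge0// ltW.
have CD2 : 0 < Cfree * D ^+ 2 by rewrite mulr_gt0// exprn_gt0.
(* Passing from r to 1 - x ^ 2, and from d / dr to d / dx, costs four factors D
   for ln K and two for the ln t_i. *)
exists (Ctr * D ^+ 4 + Cfree * D ^+ 2); first exact: ltr_wpDl CD4 CD2.
move=> X A g ghat q e lambda phi y eps t t1 t2 t3 gC _ gS _ _ [ys yhyp ypol].
move=> _ _ _ _ _ /andP[e0 eT] gW.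
have Ce2 : 0 <= Ctr * eps ^+ 2 by rewrite mulr_ge0// exprn_ge0// ltW.
have Ce : 0 <= Cfree * eps by rewrite mulr_ge0// ltW.
have [ytr yfree] : radial_decay delta0 (Ctr * eps ^+ 2) 2 (y ord0) /\
    forall i : 'I_3, radial_decay delta0 (Cfree * eps) 0 (y (lift ord0 i)).
  have [hyp|nhyp] := pselect (hyperbolic A g).
    by split=> [|i]; apply: radial_decay0 => //; exact: yhyp.
  have [p0 [I [_ Is pol yE]]] := ypol nhyp.
  have sI b : smooth1 (I b) by have [] := Is b.
  have I0 b x : 0 <= x <= 1 -> 0 < I b x by have [_ _] := Is b; apply.
  have curvI := polar_curvature (ltnW (ltnW n3)) (cce_einstein gC) gS gW pol sI I0.
  split=> [|i].
    by apply: (trace_decay n3 sI I0 hdelta0 curvI) => x /yE[].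
  by apply: (ratio_decay n3 sI I0 hdelta0 curvI) => [|x /yE[_ ->]//]; rewrite ltW.
move=> d x d12 xd.
have m0 j : 0 <= (1 - x ^+ 2) ^+ j.
  by apply: exprn_ge0; have /andP[? ?] := xd; nra.
have leCtr z j : z <= Ctr * eps ^+ 2 / delta0 ^+ 4 * (1 - x ^+ 2) ^+ j ->
    z <= (Ctr * D ^+ 4 + Cfree * D ^+ 2) * eps ^+ 2 * (1 - x ^+ 2) ^+ j.
  move=> zm; apply: (le_trans zm); apply: ler_wpM2r => //.
  rewrite -exprVn -/D mulrAC; apply: ler_wpM2r; first exact: sqr_ge0.
  by rewrite lerDl ltW.
have leCfree z j : z <= Cfree * eps / delta0 ^+ 2 * (1 - x ^+ 2) ^+ j ->
    z <= (Ctr * D ^+ 4 + Cfree * D ^+ 2) * eps * (1 - x ^+ 2) ^+ j.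
  move=> zm; apply: (le_trans zm); apply: ler_wpM2r => //.
  rewrite -exprVn -/D mulrAC; apply: ler_wpM2r; first exact: ltW.
  by rewrite lerDr.
have [b1 b2] := radial_decay_bound (ys ord0) hdelta0 Ce2 ytr xd.
have bfree i := radial_decay_bound (ys (lift ord0 i)) hdelta0 Ce (yfree i) xd.
case: d d12 => [|[|[|//]]] // _; split=> [|i].
- exact: leCtr.
- by have [c1 _] := bfree i; exact: leCfree.
- exact: leCtr.
- by have [_ c2] := bfree i; exact: leCfree.
Qed.
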